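(* Let $p\in(1,2]$ and $q\in[2,\infty)$, let $p'$ be the conjugate exponent of $q$ ($\frac1q+\frac1{p'}=1$), and let $r=\min\{p,p'\}$. Let $(\mathcal B,\|\cdot\|)$ be a real Banach space that is $q$-uniformly convex with $K_q(\mathcal B)\le K<\infty$. Let $F:\mathcal B\to\mathbb R$ and $\Delta_1<\infty$, $L_0,L_1\ge0$ with $L_0+L_1>0$, $\sigma>0$ be such that: (1) $F(x_1)-\inf_{x\in\mathcal B}F(x)\le\Delta_1$; (2) $F$ is $(L_0,L_1)$-smooth; (3) $\mathbb E[\nabla f(x,\xi)]=\nabla F(x)$ and $\mathbb E[\|\nabla f(x,\xi)-\nabla F(x)\|_*^p]\le\sigma^p$ for all $x\in\mathcal B$. Let $T\in\mathbb N_{\ge1}$. Then the iterates of NSSD-M with constant parameters $$\eta_t\equiv\eta=\min\Big\{\frac{1-\beta}{5L_1},\sqrt{\frac{\Delta_1(1-\beta)}{L_0T}}\Big\},$$ $$\beta_t\equiv\beta=1-\min\Big\{1,\max\Big\{\Big(\frac{\Delta_1L_0}{\sigma^2K^2T}\Big)^{\frac{r}{3r-2}},\Big(\frac{5L_1\Delta_1}{2\sigma KT}\Big)^{\frac{r}{2r-1}},T^{-\frac{r}{2r-1}}\Big\}\Big\}$$ satisfy $$\frac1T\sum_{t=1}^T\mathbb E[\|\nabla F(x_t)\|_*]\le12\frac{\Delta_1L_1}{T}+9\sqrt{\frac{\Delta_1L_0}{T}}+14\Big(\frac{\Delta_1L_1(\sigma K)^{\frac r{r-1}}}{T}\Big)^{\frac{r-1}{2r-1}}+14\Big(\frac{\Delta_1L_0(\sigma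 K)^{\frac r{r-1}}}{T}\Big)^{\frac{r-1}{3r-2}}+\frac{10\,\sigma K}{T^{\frac{r-1}{2r-1}}}.$$ In particular, there is a constant $C$ depending only on $r$ such that for every $\varepsilon>0$ the left-hand side is at most $\varepsilon$ whenever $$T\ge C\Big(\frac{\Delta_1L_1}{\varepsilon}+\frac{\Delta_1L_0}{\varepsilon^2}+\frac{\Delta_1L_1}{\varepsilon}\Big(\frac{\sigma K}{\varepsilon}\Big)^{\frac r{r-1}}+\frac{\Delta_1L_0}{\varepsilon^2}\Big(\frac{\sigma K}{\varepsilon}\Big)^{\frac r{r-1}}+\Big(\frac{\sigma K}{\varepsilon}\Big)^{\frac{2r-1}{r-1}}\Big).$$
   Context: $(\mathcal B^*,\|\cdot\|_* )$ is the dual Banach space, $\langle x^*,x\rangle=x^*(x)$ the duality pairing, and $\nabla F(x)\in\mathcal B^*$ denotes the Fréchet derivative of $F$ at $x$. The stochastic gradient oracle is a map $(x,\xi)\mapsto\nabla f(x,\xi)\in\mathcal B^*$, where $\xi$ is a random variable. In the definition of $\eta$, a term with denominator zero is read as $+\infty$. $(L_0,L_1)$-smoothness: $F$ is (Fréchet) differentiable and for all $x,y\in\mathcal B$, $\|\nabla F(x)-\nabla F(y)\|_*\le(L_0+L_1\|\nabla F(x)\|_* )\,A(L_1\|x-y\|)\,\|x-y\|$, where $A(c)=\frac{e^c-1}{c}$, $A(0)=1$. NSSD-M (normalised stochastic steepest descent with momentum): given an initial point $x_1\in\mathcal B$, stepsizes $\eta_t$, momentum parameters $\beta_t\in[0,1)$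 and independent copies $\xi_1,\xi_2,\dots$ of $\xi$, set $m_0=\nabla f(x_1,\xi_1)$ and, for $t\ge1$, $$m_t=\beta_tm_{t-1}+(1-\beta_t)\nabla f(x_t,\xi_t),\qquad x_{t+1}=x_t+\eta_td_t,\quad d_t\in\arg\min_{\|d\|\le1}\langle m_t,d\rangle .$$ The $q$-convexity constant of a Banach space $X$ is $K_q(X)=\inf\{K\ge1:\ 2\|x\|^q+\frac{2}{K^q}\|y\|^q\le\|x+y\|^q+\|x-y\|^q\ \ \forall x,y\in X\}$; $X$ is called $q$-uniformly convex if $K_q(X)<\infty$. *)

(* Defs.v *)
From HB Require Import structures.
From mathcomp Require Import all_boot all_order all_algebra finmap.
From mathcomp Require Import all_classical all_reals all_analysis.

Set Implicit Arguments.
Unset Strict Implicit.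
Unset Printing Implicit Defensive.

Import Order.TTheory GRing.Theory Num.Theory.
Import numFieldNormedType.Exports.

Local Open Scope classical_set_scope.
Local Open Scope ring_scope.

Section DualSpace.
Context (R : realType) (B : normedModType R).

Definition dual_pred : {pred B -> R} :=
  fun f => `[< linear (f : B -> R^o) /\ continuous (f : B -> R^o) >].

Record dual_space := DualSpace {
  dual_fun :> B -> R ;
  _ : dual_fun \in dual_pred }.

HB.instance Definition _ := [isSub for dual_fun].
HB.instance Definition _ := [Choice of dual_space by <:].

Fact dual_submod_closed : submod_closed dual_pred.
Proof.
split=> [|a f g].
  apply/asboolP; split=> [b u v|u]; last exact: cst_continuous.
  by rewrite scaler0 addr0.
move=> /asboolP[lf cf] /asboolP[lg cg]; apply/asboolP; split=> [b u v|u].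
  have -> : (a *: f + g : B -> R) (b *: u + v) =
    a *: (f (b *: u + v) : R^o) + g (b *: u + v) by [].
  rewrite lf lg.
  have -> : (a *: f + g : B -> R) u = a *: (f u : R^o) + g u by [].
  have -> : (a *: f + g : B -> R) v = a *: (f v : R^o) + g v by [].
  by rewrite !scalerDr !scalerA [a * b]mulrC addrACA.
apply: (@cvgD _ R^o); last exact: cg.
by apply: (@cvgZl_tmp R R^o); exact: cf.
Qed.

HB.instance Definition _ :=
  GRing.isSubmodClosed.Build R (B -> R) dual_pred dual_submod_closed.
HB.instance Definition _ :=
  [SubChoice_isSubLmodule of dual_space by <:].

Implicit Types f g : dual_space.

Lemma dual_linear f : linear (f : B -> R^o).
Proof. by have /asboolP[] := valP f. Qed.

Lemma dual_continuous f : continuous (f : B -> R^o).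
Proof. by have /asboolP[] := valP f. Qed.

Definition dual_norm f : R := sup [set `|f x| | x in [set x : B | `|x| <= 1]].

Lemma dual_ball_nonempty f : [set `|f x| | x in [set x : B | `|x| <= 1]] !=set0.
Proof. by exists `|f 0|, 0 => //=; rewrite normr0. Qed.

Lemma dual_has_sup f : has_sup [set `|f x| | x in [set x : B | `|x| <= 1]].
Proof.
split; first exact: dual_ball_nonempty.
pose h : {linear B -> R^o} := HB.pack (f : B -> R^o)
  (GRing.isLinear.Build _ _ _ _ (f : B -> R^o) (dual_linear f)).
have : bounded_near h (nbhs 0).
  by apply/linear_bounded_continuous; exact: dual_continuous.
move=> /bounded_funP/(_ 1)[M hM]; exists M => _ [x x1 <-].
exact: hM.
Qed.

Fact dual_normD f g : dual_norm (f + g) <= dual_norm f + dual_norm g.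
Proof.
apply: ge_sup; first exact: dual_ball_nonempty.
move=> _ [x x1 <-]; rewrite (le_trans (ler_normD _ _))// lerD//.
  by apply: sup_upper_bound; [exact: dual_has_sup|exists x].
by apply: sup_upper_bound; [exact: dual_has_sup|exists x].
Qed.

Fact dual_normZ (a : R) f : dual_norm (a *: f) = `|a| * dual_norm f.
Proof.
have le b h : dual_norm (b *: h) <= `|b| * dual_norm h.
  apply: ge_sup; first exact: dual_ball_nonempty.
  move=> _ [x x1 <-]; rewrite normrM ler_wpM2l//.
  by apply: sup_upper_bound; [exact: dual_has_sup|exists x].
apply/eqP; rewrite eq_le le/=.
have [->|a0] := eqVneq a 0.
  rewrite normr0 mul0r; apply: (@le_trans _ _ `|(0 *: f : dual_space) 0|) => //.
  apply: sup_upper_bound; first exact: dual_has_sup.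
  by exists 0 => //=; rewrite normr0.
rewrite -ler_pdivlMl ?normr_gt0// -normfV.
by rewrite -{1}[f](scalerK a0) le.
Qed.

Fact dual_norm_eq0 f : dual_norm f = 0 -> f = 0.
Proof.
move=> f0; apply: val_inj; apply/funext => x /=.
have [->|x0] := eqVneq x 0.
  have := dual_linear f 0 0 0; rewrite scaler0 addr0 scale0r add0r => ->.
  have := dual_linear f 1 0 0; rewrite !scale1r addr0 => /eqP.
  by rewrite -subr_eq0 opprD addrA subrr sub0r oppr_eq0 => /eqP.
have : `|f (`|x|^-1 *: x)| <= 0.
  rewrite -f0; apply: sup_upper_bound; first exact: dual_has_sup.
  by exists (`|x|^-1 *: x) => //=; rewrite normrZ normfV normr_id mulVf// normr_eq0.
have := dual_linear f `|x|^-1 x 0; rewrite addr0 => ->.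
have -> : f 0 = 0.
  have := dual_linear f 1 0 0; rewrite !scale1r addr0 => /eqP.
  by rewrite -subr_eq0 opprD addrA subrr sub0r oppr_eq0 => /eqP.
rewrite addr0 normr_le0 scaler_eq0 invr_eq0 normr_eq0 (negbTE x0)/=.
by move=> /eqP.
Qed.

HB.instance Definition _ :=
  Lmodule_isNormed.Build R dual_space dual_normD dual_normZ dual_norm_eq0.

End DualSpace.

(* The fallback 0 of [insubd] is only reached where [F] is not differentiable. *)
Definition grad (R : realType) (B : normedModType R) (F : B -> R) (x : B) :
  dual_space B := insubd (0 : dual_space B) ('d (F : B -> R^o) x : B -> R).

Lemma gradE (R : realType) (B : normedModType R) (F : B -> R) (x : B) :
  differentiable (F : B -> R^o) x ->
  grad F x = 'd (F : B -> R^o) x :> (B -> R).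
Proof.
move=> dF; apply: insubdK; apply/asboolP; split; first exact: linearP.
exact: diff_continuous.
Qed.

Section Bochner.
Context (R : realType) (V : normedModType R).

(* [G] is the sigma-algebra: the ambient one, or the history of the samples. *)
Definition simple_map (T : Type) (G : set (set T)) (s : T -> V) : Prop :=
  finite_set (range s) /\ forall v, G (s @^-1` [set v]).

Definition strongly_measurable (T : Type) (G : set (set T)) (f : T -> V) :
    Prop :=
  exists2 s : nat -> T -> V, (forall n, simple_map G (s n)) &
    forall w, (fun n => s n w) @ \oo --> f w.

Context d (T : measurableType d) (P : probability T R).

Definition simple_mean (s : T -> V) : V :=
  \sum_(v \in range s) fine (P (s @^-1` [set v])) *: v.

(* The Bochner integral as a relation: [V] need not be complete. *)
Definition has_bochner_mean (f : T -> V) (v : V) : Prop :=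
  strongly_measurable measurable f /\
  exists s : nat -> T -> V,
    [/\ forall n, simple_map measurable (s n),
        (fun n => 'E_P[(fun w => `|f w - s n w|)%R]%E) @ \oo --> 0%E &
        (fun n => simple_mean (s n)) @ \oo --> v].

End Bochner.

Section Copies.
Context (R : realType) d d' (T : measurableType d) (X : measurableType d')
  (P : probability T R).

(* The copies are [xi 1, xi 2, ...]; [xi 0] plays no role. *)
Definition independent_copies (xi0 : {RV P >-> X}) (xi : nat -> {RV P >-> X}) :
    Prop :=
  (forall t, (1 <= t)%N -> forall A, measurable A ->
     distribution P (xi t) A = distribution P xi0 A) /\
  (forall (J : {fset nat}) (A : nat -> set X), 0%N \notin J ->
     (forall t, measurable (A t)) ->
     P (\bigcap_(t in [set` J]) xi t @^-1` A t) =
       (\prod_(t <- J) P (xi t @^-1` A t))%E).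

Definition history (xi : nat -> {RV P >-> X}) (t : nat) : set (set T) :=
  <<s \bigcup_(i in [set i | (1 <= i <= t)%N])
        preimage_set_system setT (xi i) measurable >>.

End Copies.

Definition q_convexity_constant (R : realType) (X : normedModType R) (q : R) :
    \bar R :=
  ereal_inf [set K%:E | K in [set K : R | 1 <= K /\
    forall x y : X, 2 * `|x| `^ q + 2 / K `^ q * `|y| `^ q <=
                    `|x + y| `^ q + `|x - y| `^ q]].

Definition q_uniformly_convex (R : realType) (X : normedModType R) (q : R) :
    Prop := (q_convexity_constant X q < +oo)%E.

Definition expm1_ratio (R : realType) (c : R) : R :=
  if c == 0 then 1 else (expR c - 1) / c.

Definition L0L1_smooth (R : realType) (B : normedModType R) (F : B -> R)
    (L0 L1 : R) : Prop :=
  (forall x, differentiable (F : B -> R^o) x) /\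
  forall x y, `|grad F x - grad F y| <=
    (L0 + L1 * `|grad F x|) * expm1_ratio (L1 * `|x - y|) * `|x - y|.

(* Joint measurability of an oracle: a measurable random point and a measurable
   sample yield a measurable random gradient.  If [B] and its dual are
   separable, this is measurability of [g] on [B * X] for the Borel sets. *)
Definition oracle_measurable (R : realType) (B : normedModType R)
    d' (X : measurableType d') (g : B -> X -> dual_space B) : Prop :=
  forall d (T : measurableType d) (x : T -> B) (xi : T -> X),
    strongly_measurable measurable x -> measurable_fun setT xi ->
    strongly_measurable measurable (fun w => g (x w) (xi w)).

Definition is_argmin_ball (R : realType) (B : normedModType R)
    (m : dual_space B) (u : B) : Prop :=
  `|u| <= 1 /\ forall v : B, `|v| <= 1 -> m u <= m v.

(* Where the minimiser is not unique, [nssdm_adapted] lets its choice depend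
   (measurably) on the samples drawn so far but not on later ones. *)
Record NSSDM (R : realType) (B : normedModType R)
    d d' (T : measurableType d) (X : measurableType d') (P : probability T R)
    (xi : nat -> {RV P >-> X}) (g : B -> X -> dual_space B) (x1 : B)
    (eta beta : nat -> R)
    (x : nat -> T -> B) (m : nat -> T -> dual_space B) (dir : nat -> T -> B) :
    Prop := {
  nssdm_point1 : forall w, x 1%N w = x1 ;
  nssdm_momentum0 : forall w, m 0%N w = g x1 (xi 1%N w) ;
  nssdm_momentum : forall t w, (1 <= t)%N ->
    m t w = beta t *: m t.-1 w + (1 - beta t) *: g (x t w) (xi t w) ;
  nssdm_direction : forall t w, (1 <= t)%N -> is_argmin_ball (m t w) (dir t w) ;
  nssdm_adapted : forall t, (1 <= t)%N ->
    strongly_measurable (history xi t) (dir t) ;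
  nssdm_step : forall t w, (1 <= t)%N ->
    x t.+1 w = x t w + eta t *: dir t w }.

Section Tuning.
Context (R : realType).

Definition nssdm_beta (r K Delta1 L0 L1 sigma : R) (T : nat) : R :=
  1 - Num.min 1 (Num.max (Num.max
    ((Delta1 * L0 / (sigma ^+ 2 * K ^+ 2 * T%:R)) `^ (r / (3 * r - 2)))
    ((5 * L1 * Delta1 / (2 * sigma * K * T%:R)) `^ (r / (2 * r - 1))))
    (T%:R `^ (- (r / (2 * r - 1))))).

(* A term of the minimum with denominator zero is [+oo]; the minimum is finite
   as soon as [L0] and [L1] are not both zero. *)
Definition nssdm_eta (Delta1 L0 L1 : R) (T : nat) (beta : R) : R :=
  fine (Order.min
    (if (5 * L1 == 0)%R then +oo else ((1 - beta) / (5 * L1))%:E)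
    (if (L0 * T%:R == 0)%R then +oo
     else (Num.sqrt (Delta1 * (1 - beta) / (L0 * T%:R)))%:E))%E.

End Tuning.

(* Main.v *)
From HB Require Import structures.
Require Import Defs.
From mathcomp Require Import all_boot all_order all_algebra finmap.
From mathcomp Require Import all_classical all_reals all_analysis.
From mathcomp Require Import measurable_realfun.
From mathcomp Require Import ring lra.

Set Implicit Arguments.
Unset Strict Implicit.
Unset Printing Implicit Defensive.

Import Order.TTheory GRing.Theory Num.Theory.
Import numFieldNormedType.Exports.

Local Open Scope classical_set_scope.
Local Open Scope ring_scope.

(** The theorem combines a pathwise analysis of normalised steepest descent
    with a moment inequality for the noise in the dual space.

    Write $\alpha=1-\beta$ and $N_t=\nabla f(x_t,\xi_t)-\nabla F(x_t)$.  For each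
    outcome, [normalised_step_descent] says that a step decreases $F$ by
    $\eta\|\nabla F(x_t)\|$ up to $2\eta\|m_t-\nabla F(x_t)\|$ and a curvature term.
    Unrolling the momentum recursion splits $m_t-\nabla F(x_t)$ into a noise part
    $V_t=\beta^{t-1}N_1+\alpha\sum_{2\le i\le t}\beta^{t-i}N_i$ and a drift, which
    sums up to a multiple of $\frac{\beta\eta}\alpha\sum_t(L_0+L_1\|\nabla F(x_t)\|)$
    ([momentum_drift]).  As $\eta L_1\le\alpha/5$, the part of drift and curvature
    that is proportional to the gradient norms is absorbed on the left-hand side,
    and [pathwise_bound] remains: the sum of the gradient norms is at most a
    deterministic quantity plus a multiple of $\sum_t\|V_t\|$.

    The noise is estimated through the geometry of the space.  By Young's
    inequality, $q$-convexity of $\mathcal B$ with constant $K$ dualises to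
    $\|f+g\|^r+\|f-g\|^r\le2\|f\|^r+2K^r\|g\|^r$ in $\mathcal B^*$ ([dual_smooth]).
    If $D$ is centred, then $\mathbb E\|f-D\|^r\ge\|f\|^r$, whence
    $\mathbb E\|f+D\|^r\le\|f\|^r+2K^r\mathbb E\|D\|^r$ ([mean_zero_step]).  A fresh
    sample is independent of the past, so by Fubini's theorem this applies at each
    step with the past held fixed ([fresh_sample_fubini], [fresh_noise_step]).
    Induction gives $\mathbb E\|V_t\|\le\beta^{t-1}\sigma+2\sigma K\alpha^{(r-1)/r}$.

    Altogether the average gradient norm is at most
    $\frac53\big(\frac{\Delta_1}{\eta T}+\frac{2\eta L_0}\alpha+\frac{2\sigma}{\alpha T}
    +4\sigma K\alpha^{(r-1)/r}\big)$ ([average_gradient_interior]), and with the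
    prescribed stepsize the first two terms are at most
    $\frac{5\Delta_1L_1}{\alpha T}+3\sqrt{\frac{\Delta_1L_0}{\alpha T}}$.  The three
    candidates in the definition of $\alpha$ balance the decreasing terms
    against the noise ([tuned_bound_interior]).  If $\alpha$ is truncated at $1$
    there is no momentum, the noise is dominated by another term, and the smaller
    factor $\frac87$ is available ([average_gradient_boundary],
    [tuned_bound_boundary]).  The stepsize can only vanish when $\Delta_1=0$, and
    then the iterates stay at a minimiser.  The sample complexity follows by making
    each of the five terms at most $\varepsilon/5$ ([complexity_bound]). *)

(** * Powers and tangents *)

Section RealInequalities.
Context (R : realType).
Implicit Types (a b c r s z : R).

Lemma expm1_ratio_ge0 c : 0 <= c -> 0 <= expm1_ratio c.
Proof.
rewrite /expm1_ratio; case: eqP => // _ c0; apply: divr_ge0 => //.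
by rewrite subr_ge0 (le_trans _ (expR_ge1Dx _))// lerDl.
Qed.

(** From $e^{-c}\ge1-c$. *)
Lemma expm1_ratio_le c : 0 <= c < 1 -> expm1_ratio c <= (1 - c)^-1.
Proof.
move=> /andP[c0 c1]; rewrite /expm1_ratio; case: eqVneq => [->|cn0].
  by rewrite subr0 invr1.
have cp : 0 < c by rewrite lt_neqAle eq_sym cn0.
have d0 : 0 < 1 - c by rewrite subr_gt0.
have h : expR c <= (1 - c)^-1.
  rewrite -[expR c]invrK -expRN lef_pV2 ?posrE ?expR_gt0//.
  exact: (expR_ge1Dx (- c)).
rewrite ler_pdivrMr// lerBlDr (le_trans h)//.
rewrite le_eqVlt; apply/orP; left; apply/eqP; field; by rewrite gt_eqF.
Qed.

(** The tangent at $b^s$ to the concave function $z\mapsto z^{r/s}$, evaluated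
    at $z^s$; a form of Young's inequality. *)
Lemma powR_le_tangent r s z b : 0 < r <= s -> 0 <= z -> 0 < b ->
  z `^ r <= r / s * z `^ s * b `^ (r - s) + (1 - r / s) * b `^ r.
Proof.
move=> /andP[r0 rs] z0 b0; have s0 : 0 < s := lt_le_trans r0 rs.
have [->|rns] := eqVneq r s.
  by rewrite divff ?gt_eqF// subrr powRr0 mul1r mulr1 subrr mul0r addr0.
have {rns}rs : r < s by rewrite lt_neqAle rns.
have unit (u : R) : 0 <= u -> u `^ r <= r / s * u `^ s + (1 - r / s).
  move=> u0.
  have H : 0 < s / r -> 0 < s / (s - r) -> (s / r)^-1 + (s / (s - r))^-1 = 1 ->
      u `^ r * 1 <= (u `^ r) `^ (s / r) / (s / r) +
                    1 `^ (s / (s - r)) / (s / (s - r)).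
    exact: conjugate_powR (powR_ge0 _ _) ler01.
  rewrite mulr1 powR1 -(powRrM u r) (_ : r * (s / r) = s) in H; last first.
    by field; rewrite gt_eqF.
  have sr0 : 0 < s - r by rewrite subr_gt0.
  apply: (le_trans (H _ _ _)); rewrite ?divr_gt0//.
    by field; rewrite !gt_eqF.
  rewrite le_eqVlt; apply/orP; left; apply/eqP; field; by rewrite !gt_eqF.
have := unit (z / b) (divr_ge0 z0 (ltW b0)).
rewrite !powRM ?invr_ge0// ?(ltW b0)// -(powR_inv1 (ltW b0)) -!powRrM !mulN1r.
move=> h; have br : 0 < b `^ r by rewrite powR_gt0.
rewrite -(ler_pM2r br) in h; apply: le_trans (le_trans _ h) _.
  by rewrite -mulrA -powRD ?addNr ?powRr0 ?mulr1// (gt_eqF b0) implybT.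
rewrite mulrDl -!mulrA -powRD ?[- s + r]addrC//.
by rewrite (gt_eqF b0) implybT.
Qed.

Lemma powR_ge_tangent r z a : 1 <= r -> 0 <= z -> 0 <= a ->
  a `^ r + r * a `^ (r - 1) * (z - a) <= z `^ r.
Proof.
move=> r1 z0; rewrite le_eqVlt => /predU1P[<-|a0].
  have rp : 0 < r by exact: lt_le_trans r1.
  rewrite powR0 ?gt_eqF// add0r subr0.
  have [->|rn1] := eqVneq r 1; first by rewrite subrr powRr0 !mul1r powRr1.
  by rewrite powR0 ?mulr0 ?mul0r ?powR_ge0// subr_eq0.
have rp : 0 < r by exact: lt_le_trans r1.
have := @powR_le_tangent 1 r z a; rewrite ltr01 r1 => /(_ isT z0 a0).
rewrite !powRr1 ?(ltW a0)// => h.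
have k : 0 < r * a `^ (r - 1) by rewrite mulr_gt0// powR_gt0.
rewrite -(ler_pM2l k) in h.
have aa : a `^ (r - 1) * a `^ (1 - r) = 1.
  by rewrite -powRD ?(gt_eqF a0) ?implybT// addrC addrA subrK subrr powRr0.
have aD : a `^ r = a `^ (r - 1) * a by rewrite mulrC mulr_powRB1// ltW.
have e : r * a `^ (r - 1) * (1 / r * z `^ r * a `^ (1 - r) + (1 - 1 / r) * a) =
  z `^ r + (r - 1) * a `^ r.
  transitivity (z `^ r * (a `^ (r - 1) * a `^ (1 - r)) + (r - 1) * a `^ r).
    by rewrite aD; field; rewrite gt_eqF.
  by rewrite aa mulr1.
rewrite e in h; rewrite mulrBr -[X in _ - X]mulrA -aD; lra.
Qed.

Lemma powR_subadditive s a b : 0 < s <= 1 -> 0 <= a -> 0 <= b ->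
  (a + b) `^ s <= a `^ s + b `^ s.
Proof.
move=> /andP[s0 s1] a0 b0; have := addr_ge0 a0 b0.
rewrite le_eqVlt => /predU1P[/esym e|ab0].
  by rewrite e powR0 ?gt_eqF// addr_ge0// powR_ge0.
have key (z : R) : 0 <= z -> z <= a + b -> z * (a + b) `^ (s - 1) <= z `^ s.
  move=> z0 zab; have [->|zn0] := eqVneq z 0; first by rewrite mul0r powR_ge0.
  have zp : 0 < z by rewrite lt_neqAle eq_sym zn0.
  rewrite -(mulr_powRB1 z0 s0) ler_wpM2l//.
  rewrite -[s - 1]opprK ![_ `^ (- - _)]powRN lef_pV2 ?posrE ?powR_gt0//.
  by rewrite ge0_ler_powR ?nnegrE ?opprB ?subr_ge0// ltW.
rewrite -(mulr_powRB1 (ltW ab0) s0) mulrDl lerD// key// ?lerDl ?lerDr//.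
Qed.

(** Power means increase with the exponent while $\ell^s$-norms decrease, so
    an averaged $s$-inequality self-improves to any smaller exponent. *)
Lemma powR_average_interp r s a b c d : 0 < r <= s ->
  0 <= a -> 0 <= b -> 0 <= c -> 0 <= d ->
  a `^ s + b `^ s <= 2 * (c `^ s + d `^ s) ->
  a `^ r + b `^ r <= 2 * (c `^ r + d `^ r).
Proof.
move=> /andP[r0 rs] a0 b0 c0 d0 h; have s0 : 0 < s := lt_le_trans r0 rs.
pose w := c `^ s + d `^ s.
have := addr_ge0 (powR_ge0 c s) (powR_ge0 d s); rewrite -/w le_eqVlt.
have pw (z : R) : 0 <= z -> (z `^ s) `^ (r / s) = z `^ r.
  by move=> z0; rewrite -powRrM; congr powR; field; by rewrite gt_eqF.
move=> /predU1P[/esym w0|w0].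
  move: h; rewrite -/w w0 mulr0 => h.
  have := powR_ge0 a s; have := powR_ge0 b s => bs as_.
  have /powR_eq0_eq0-> : a `^ s = 0 by apply/eqP; rewrite eq_le as_ andbT; lra.
  have /powR_eq0_eq0-> : b `^ s = 0 by apply/eqP; rewrite eq_le bs andbT; lra.
  by rewrite powR0 ?gt_eqF// addr0 mulr_ge0// addr_ge0 ?powR_ge0.
have rs1 : 0 < r / s <= 1 by rewrite divr_gt0//= ler_pdivrMr// mul1r.
have tan (z : R) : 0 <= z ->
  z `^ r <= r / s * z `^ s * w `^ (r / s - 1) + (1 - r / s) * w `^ (r / s).
  move=> z0; rewrite -{1}(pw z z0).
  have := @powR_le_tangent (r / s) 1 (z `^ s) w rs1 (powR_ge0 _ _) w0.
  by rewrite !divr1 powRr1 ?powR_ge0.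
have le : w `^ (r / s) <= c `^ r + d `^ r.
  by rewrite -(pw c c0) -(pw d d0) powR_subadditive ?powR_ge0.
apply: le_trans (lerD (tan a a0) (tan b b0)) _.
apply: le_trans (_ : 2 * w `^ (r / s) <= _); last by rewrite ler_wpM2l.
have ww : w * w `^ (r / s - 1) = w `^ (r / s).
  by rewrite mulr_powRB1// ?(ltW w0)//; case/andP: rs1.
have k : 0 <= r / s * w `^ (r / s - 1).
  by rewrite mulr_ge0 ?powR_ge0//; case/andP: rs1 => /ltW.
have := ler_wpM2l k h; rewrite -/w.
rewrite (_ : _ * (2 * w) = 2 * (r / s) * w `^ (r / s)) => [{}h|]; first lra.
by rewrite -ww; ring.
Qed.

End RealInequalities.

(** * The dual space and its smoothness *)

Section DualBasics.
Context (R : realType) (B : normedModType R).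
Implicit Types (f g : dual_space B) (u v : B) (a : R).

Lemma dual_applyD f g u : (f + g) u = f u + g u. Proof. by []. Qed.

Lemma dual_applyB f g u : (f - g) u = f u - g u. Proof. by []. Qed.

Lemma dual_applyZ a f u : (a *: f) u = a * f u. Proof. by []. Qed.

Lemma dual0 f : f 0 = 0.
Proof.
have := dual_linear f (-1) 0 0; rewrite scaler0 addr0 => ->.
by rewrite scaleN1r addNr.
Qed.

Lemma dualZ f a u : f (a *: u) = a * f u.
Proof. by have := dual_linear f a u 0; rewrite addr0 dual0 addr0. Qed.

Lemma dualD f u v : f (u + v) = f u + f v.
Proof. by have := dual_linear f 1 u v; rewrite !scale1r. Qed.

Lemma dualN f u : f (- u) = - f u.
Proof. by rewrite -scaleN1r dualZ mulN1r. Qed.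

Lemma dualB f u v : f (u - v) = f u - f v.
Proof. by rewrite dualD dualN. Qed.

Lemma dual_apply_le1 f u : `|u| <= 1 -> `|f u| <= `|f|.
Proof. by move=> u1; apply: sup_upper_bound; [exact: dual_has_sup|exists u]. Qed.

Lemma dual_apply_le f u : `|f u| <= `|f| * `|u|.
Proof.
have [->|u0] := eqVneq u 0; first by rewrite dual0 !normr0 mulr0.
have up : 0 < `|u| by rewrite normr_gt0.
have := @dual_apply_le1 f (`|u|^-1 *: u).
rewrite normrZ normfV normr_id mulVf ?gt_eqF// => /(_ (lexx _)).
by rewrite dualZ normrM normfV normr_id mulrC ler_pdivrMr.
Qed.

Lemma dual_norm_le f (c : R) :
  (forall u, `|u| <= 1 -> `|f u| <= c) -> `|f| <= c.
Proof.
move=> h; apply: ge_sup; first exact: dual_ball_nonempty.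
by move=> _ [u u1 <-]; exact: h.
Qed.

(** The supremum in the dual norm need not be attained, so almost norming
    vectors take the place of norming ones. *)
Lemma dual_almost_norming f (e : R) : 0 < e ->
  exists2 u, `|u| <= 1 & `|f| - e < f u.
Proof.
move=> e0; have [_ [u u1 <-] h] := sup_adherent e0 (dual_has_sup f).
have [fu|fu] := leP 0 (f u); first by exists u => //; rewrite ger0_norm in h.
rewrite ltr0_norm// in h.
by exists (- u); rewrite ?normrN// dualN.
Qed.

Lemma argmin_ball_le f u : is_argmin_ball f u -> f u <= - `|f|.
Proof.
move=> [u1 umin]; rewrite lerNr; apply: dual_norm_le => v v1.
rewrite ler_norml opprK umin//= lerNr -dualN.
by rewrite umin// normrN.
Qed.

End DualBasics.

Section DualSmoothness.
Context (R : realType) (B : normedModType R).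

(** The infimum defining the convexity constant is attained: the inequality is
    closed in the constant. *)
Lemma q_convexity_constant_le (q K : R) : 0 < q ->
  (q_convexity_constant B q <= K%:E)%E ->
  1 <= K /\ forall x y : B,
    2 * `|x| `^ q + 2 / K `^ q * `|y| `^ q <= `|x + y| `^ q + `|x - y| `^ q.
Proof.
move=> q0 hK.
have near (e : R) : 0 < e -> exists k, [/\ 1 <= k, k < K + e & forall x y : B,
    2 * `|x| `^ q + 2 / k `^ q * `|y| `^ q <= `|x + y| `^ q + `|x - y| `^ q].
  move=> e0; have : (q_convexity_constant B q < (K + e)%:E)%E.
    by rewrite (le_lt_trans hK)// lte_fin ltrDl.
  by move=> /ereal_inf_lt[_ [k [k1 hk] <-]]; rewrite lte_fin; exists k.
have K1 : 1 <= K.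
  apply/ler_addgt0Pr => e /near[k [k1 kK _]].
  exact: le_trans k1 (ltW kK).
split=> // x y.
have K0 : 0 < K := lt_le_trans ltr01 K1.
pose S := `|x + y| `^ q + `|x - y| `^ q; rewrite -/S.
have [y0|y0] := eqVneq (`|y| `^ q) 0.
  have [k [k1 _ /(_ x y)]] := near 1 ltr01.
  by rewrite y0 !mulr0.
have yp : 0 < `|y| `^ q by rewrite lt_neqAle eq_sym y0 powR_ge0.
(* With $D = S - 2\|x\|^q$, the claim reads $2\|y\|^q\le D\,K^q$, which is the
   limit of $(2\|y\|^q/D)^{1/q}\le K+\varepsilon$. *)
have H (e : R) : 0 < e -> 2 * `|y| `^ q <= (S - 2 * `|x| `^ q) * (K + e) `^ q.
  move=> /near[k [k1 kK /(_ x y)]]; rewrite -/S => h.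
  have kp : 0 < k := lt_le_trans ltr01 k1.
  have kq : 0 < k `^ q by rewrite powR_gt0.
  have h' : 2 * `|y| `^ q <= (S - 2 * `|x| `^ q) * k `^ q.
    rewrite -ler_pdivrMr// -[X in X <= _]mulrA [_ / k `^ q]mulrC mulrA; lra.
  apply: le_trans h' _; rewrite ler_wpM2l//; last first.
    by rewrite ge0_ler_powR ?(ltW q0)// ?nnegrE ?(ltW kp)// ?ltW// (lt_trans kp).
  have : 0 <= 2 / k `^ q * `|y| `^ q by rewrite !mulr_ge0 ?invr_ge0 ?powR_ge0.
  lra.
pose D := S - 2 * `|x| `^ q.
have D0 : 0 < D.
  have := H 1 ltr01; rewrite -/D; case: (leP D 0) => // D0 h.
  have := mulr_ge0_le0 (powR_ge0 (K + 1) q) D0; rewrite mulrC; lra.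
have yD : 0 <= 2 * `|y| `^ q / D.
  by apply: divr_ge0; [apply: mulr_ge0 => //; exact: ltW|exact: ltW].
have KK : 2 * `|y| `^ q / D <= K `^ q.
  have -> : 2 * `|y| `^ q / D = ((2 * `|y| `^ q / D) `^ q^-1) `^ q.
    by rewrite -powRrM mulVf ?gt_eqF// powRr1.
  rewrite ge0_ler_powR ?(ltW q0)// ?nnegrE ?powR_ge0 ?(ltW K0)//.
  apply/ler_addgt0Pr => e e0.
  have -> : K + e = ((K + e) `^ q) `^ q^-1.
    by rewrite -powRrM mulfV ?gt_eqF// powRr1// addr_ge0 ?(ltW K0) ?(ltW e0).
  rewrite ge0_ler_powR ?invr_ge0 ?(ltW q0)// ?nnegrE ?powR_ge0//.
  by rewrite ler_pdivrMr// [leRHS]mulrC H.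
have Kq : 0 < K `^ q by rewrite powR_gt0.
move: KK; rewrite ler_pdivrMr// [leRHS]mulrC -ler_pdivrMr// /D.
by rewrite [2 / _ * _]mulrAC; lra.
Qed.

(** Test $f+g$ and $f-g$ on almost norming vectors of length
    $a=\|f+g\|^{p'-1}$ and $b=\|f-g\|^{p'-1}$, regroup into half sum and half
    difference, and apply Young's inequality: the convexity inequality
    bounds the result by $\frac2{p'}(\dots)+\frac1q(a^q+b^q)$, and
    $a^q=\|f+g\|^{p'}$ is absorbed on the left. *)
Lemma dual_smooth_conjugate (q p' K : R) : 1 < q -> 1 < p' ->
  q^-1 + p'^-1 = 1 -> 1 <= K ->
  (forall x y : B,
    2 * `|x| `^ q + 2 / K `^ q * `|y| `^ q <=
      `|x + y| `^ q + `|x - y| `^ q) ->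
  forall f g : dual_space B,
    `|f + g| `^ p' + `|f - g| `^ p' <= 2 * (`|f| `^ p' + (K * `|g|) `^ p').
Proof.
move=> q1 p1 qp K1 hK f g.
have q0 : 0 < q := lt_trans ltr01 q1.
have p0 : 0 < p' := lt_trans ltr01 p1.
have K0 : 0 < K := lt_le_trans ltr01 K1.
have pq : (p' - 1) * q = p'.
  have : (q^-1 + p'^-1) * (p' * q) = p' * q by rewrite qp mul1r.
  rewrite mulrDl mulrCA mulVf ?gt_eqF// mulKf ?gt_eqF//; lra.
have weight (z : R) : 0 <= z ->
    exists a, [/\ 0 <= a, a `^ q = z `^ p' & a * z = z `^ p'].
  move=> z0; exists (z `^ (p' - 1)); split; first exact: powR_ge0.
    by rewrite -powRrM pq.
  by rewrite mulrC mulr_powRB1.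
have [a [a0 aq af]] := weight _ (normr_ge0 (f + g)).
have [b [b0 bq bf]] := weight _ (normr_ge0 (f - g)).
have [S SE] : exists S, S = `|f + g| `^ p' + `|f - g| `^ p' by eexists.
have [Z ZE] : exists Z, Z = `|f| `^ p' + (K * `|g|) `^ p' by eexists.
rewrite -SE -ZE.
have young (c d : R) : 0 <= c -> 0 <= d -> c * d <= p'^-1 * c `^ p' + q^-1 * d `^ q.
  move=> c0 d0; rewrite ![_^-1 * _]mulrC; apply: conjugate_powR => //.
  by rewrite addrC.
have main (e : R) : 0 < e -> S - e <= 2 / p' * Z + S / q.
  move=> e0; have ab1 : 0 < a + b + 1 by rewrite ltr_wpDl// addr_ge0.
  have [e' e'0 e'E] : exists2 e', 0 < e' & e' * (a + b + 1) = e.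
    by exists (e / (a + b + 1)); [rewrite divr_gt0|rewrite divfK ?gt_eqF].
  have [x x1 hx] := dual_almost_norming (f + g) e'0.
  have [y y1 hy] := dual_almost_norming (f - g) e'0.
  pose X := 2^-1 *: (a *: x + b *: y); pose Y := 2^-1 *: (a *: x - b *: y).
  have XY : X + Y = a *: x.
    rewrite /X /Y -scalerDr addrACA subrr addr0 -scalerDl scalerA.
    by congr (_ *: _); field.
  have XYm : X - Y = b *: y.
    rewrite /X /Y -scalerBr opprB addrC addrA subrK -scalerDl scalerA.
    by congr (_ *: _); field.
  have lo : S - e <= a * (f + g) x + b * (f - g) y.
    have h1 := ler_wpM2l a0 (ltW hx); have h2 := ler_wpM2l b0 (ltW hy).
    rewrite mulrBr af in h1; rewrite mulrBr bf in h2.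
    have h3 : a * e' + b * e' <= e.
      by rewrite -mulrDl -e'E mulrC ler_wpM2l ?(ltW e'0)// lerDl.
    rewrite SE; clear - h1 h2 h3; lra.
  have sp : a * (f + g) x + b * (f - g) y = 2 * (f X + g Y).
    have hf : f X = 2^-1 * (a * f x + b * f y) by rewrite dualZ dualD !dualZ.
    have hg : g Y = 2^-1 * (a * g x - b * g y) by rewrite dualZ dualB !dualZ.
    by rewrite hf hg dual_applyD dual_applyB; field.
  have fX : f X <= p'^-1 * `|f| `^ p' + q^-1 * `|X| `^ q.
    apply: le_trans (ler_norm _) (le_trans (dual_apply_le _ _) _).
    by apply: young; rewrite normr_ge0.
  have gY : g Y <= p'^-1 * (K * `|g|) `^ p' + q^-1 * (`|Y| `^ q / K `^ q).
    apply: le_trans (ler_norm _) (le_trans (dual_apply_le _ _) _).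
    have -> : `|g| * `|Y| = (K * `|g|) * (`|Y| / K) by field; rewrite gt_eqF.
    apply: le_trans (young _ _ _ _) _.
    - by rewrite mulr_ge0// ltW.
    - by rewrite divr_ge0// ltW.
    - rewrite lerD2l ler_wpM2l ?invr_ge0 ?(ltW q0)//.
      rewrite powRM ?invr_ge0 ?(ltW K0)// -(powR_inv1 (ltW K0)) -powRrM mulN1r.
      by rewrite powRN.
  have le1 (c : R) (z : B) : 0 <= c -> `|z| <= 1 -> `|c *: z| `^ q <= c `^ q.
    move=> c0 z1; rewrite ge0_ler_powR ?nnegrE ?(ltW q0)//.
    by rewrite normrZ ger0_norm// ler_piMr.
  have := hK X Y; rewrite XY XYm.
  have := le1 a x a0 x1; have := le1 b y b0 y1; rewrite aq bq => h1 h2 h3.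
  have h4 : 2 * (`|X| `^ q + `|Y| `^ q / K `^ q) <= S.
    rewrite SE; apply: le_trans (le_trans h3 (lerD h2 h1)).
    by rewrite le_eqVlt; apply/orP; left; apply/eqP; ring.
  have h5 : q^-1 * (2 * (`|X| `^ q + `|Y| `^ q / K `^ q)) <= q^-1 * S.
    by rewrite ler_wpM2l ?invr_ge0 ?(ltW q0).
  rewrite ZE; move: lo; rewrite sp; clear - fX gY h5; lra.
have : S <= 2 / p' * Z + S / q.
  by apply/ler_addgt0Pr => e /main; clear; lra.
have qE : q^-1 = 1 - p'^-1 by rewrite -qp addrK.
rewrite qE => h; have {}h : p'^-1 * S <= p'^-1 * (2 * Z) by clear - h; lra.
by rewrite ler_pM2l ?invr_gt0 in h.
Qed.

(** Interpolation from the conjugate exponent $p'$ to a smaller exponent $r$,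
    which is what the moments of the noise call for when $p<p'$. *)
Lemma dual_smooth (q p' r K : R) : 1 < q -> 1 < p' -> q^-1 + p'^-1 = 1 ->
  0 < r <= p' -> (q_convexity_constant B q <= K%:E)%E ->
  forall f g : dual_space B,
    `|f + g| `^ r + `|f - g| `^ r <= 2 * (`|f| `^ r + (K * `|g|) `^ r).
Proof.
move=> q1 p1 qp rp hK f g.
have [K1 hc] := q_convexity_constant_le (lt_trans ltr01 q1) hK.
apply: (@powR_average_interp _ r p') => //.
  by rewrite mulr_ge0// (le_trans ler01).
exact: (@dual_smooth_conjugate q).
Qed.

End DualSmoothness.

(** * Descent along a normalised step *)

Section SmoothDescent.
Context (R : realType) (B : normedModType R).

Lemma line_is_derive (F : B -> R) (x h : B) (s : R) :
  differentiable (F : B -> R^o) (x + s *: h) ->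
  is_derive s 1 (fun t : R => F (x + t *: h) : R^o)
    (grad F (x + s *: h) h).
Proof.
move=> dF.
pose l : R -> B := cst x + *:%R ^~ h.
have dl : is_diff s l (0 + *:%R ^~ h) by exact: is_diffD.
have dl' : differentiable l s by case: dl.
have dFl : differentiable ((F : B -> R^o) \o l) s.
  by apply: differentiable_comp => //; exact: dF.
apply: DeriveDef; first exact: diff_derivable.
rewrite (_ : (fun t => _) = (F : B -> R^o) \o l)// deriveE//.
rewrite diff_comp//= (gradE dF) diff_val.
by congr ('d _ _ _); rewrite -[LHS]/(0 + 1 *: h) add0r scale1r.
Qed.

(** Along the segment from $x$ to $x+h$ the derivative of $F$ exceeds its value
    at $x$ by at most $sM$ after time $s$; integrate. *)
Lemma smooth_descent (F : B -> R) (L0 L1 : R) (x h : B) :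
  0 <= L0 -> 0 <= L1 -> L0L1_smooth F L0 L1 -> L1 * `|h| < 1 ->
  F (x + h) <= F x + grad F x h +
    (L0 + L1 * `|grad F x|) * (1 - L1 * `|h|)^-1 / 2 * `|h| ^+ 2.
Proof.
move=> L00 L10 [dF sF] c1.
have A0 : 0 < 1 - L1 * `|h| by rewrite subr_gt0.
pose M := (L0 + L1 * `|grad F x|) * (1 - L1 * `|h|)^-1 * `|h| ^+ 2.
pose phi (s : R) : R := F (x + s *: h) - (grad F x h) * s - M / 2 * s ^+ 2.
have dphi (s : R) : is_derive s 1 phi
    (grad F (x + s *: h) h - grad F x h - M * s).
  have d1 := @line_is_derive F x h s (dF _).
  have d2 : is_derive s 1 (fun t : R => grad F x h * t : R^o) (grad F x h).
    by apply: is_derive_eq; rewrite /= ?scaler0 ?addr0 ?add0r /GRing.scale/= mulr1.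
  have d3 : is_derive s 1 (fun t : R => M / 2 * t ^+ 2 : R^o) (M * s).
    apply: is_derive_eq; rewrite /GRing.scale/= !mulr1.
    by field.
  exact: (is_deriveB (is_deriveB d1 d2) d3).
have : phi 1 <= phi 0.
  apply: (@ler0_derive1_nincr _ phi 0 1) => //.
  - move=> s; rewrite in_itv/= => /andP[s0 s1].
    have [_ dE] := dphi s; rewrite derive1E dE subr_le0 -dual_applyB.
    apply: le_trans (ler_norm _) (le_trans (dual_apply_le _ _) _).
    have hx : `|x - (x + s *: h)| = s * `|h|.
      by rewrite opprD addrA subrr add0r normrN normrZ gtr0_norm.
    have L1s : L1 * (s * `|h|) <= L1 * `|h|.
      by rewrite ler_wpM2l// ler_piMl// ltW.
    have c0 : 0 <= L1 * (s * `|h|) by rewrite !mulr_ge0// ltW.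
    rewrite distrC.
    apply: le_trans (ler_wpM2r (normr_ge0 h) (sF x (x + s *: h))) _.
    rewrite hx /M expr2 -!mulrA; apply: ler_wpM2l.
      by rewrite addr_ge0// mulr_ge0.
    rewrite [leRHS](_ : _ = (1 - L1 * `|h|)^-1 * (s * (`|h| * `|h|))); last by ring.
    apply: ler_wpM2r; first by rewrite !mulr_ge0// ltW.
    apply: le_trans (expm1_ratio_le _) _; first by rewrite c0 (le_lt_trans L1s).
    by rewrite lef_pV2 ?posrE ?subr_gt0 ?(le_lt_trans L1s)// lerB.
  - by apply: derivable_within_continuous => s _; have [dp _] := dphi s; exact: dp.
rewrite /phi /M scale1r scale0r addr0; clear; lra.
Qed.

Lemma L0L1_smooth_step (F : B -> R) (L0 L1 eta : R) (x d : B) :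
  0 <= L0 -> 0 <= L1 -> 0 <= eta -> L0L1_smooth F L0 L1 -> L1 * eta < 1 ->
  `|d| <= 1 ->
  `|grad F x - grad F (x + eta *: d)| <=
    (L0 + L1 * `|grad F x|) * (1 - L1 * eta)^-1 * eta.
Proof.
move=> L00 L10 e0 [_ sF] c1 d1.
have hx : `|x - (x + eta *: d)| <= eta.
  by rewrite opprD addrA subrr add0r normrN normrZ ger0_norm// ler_piMr.
apply: le_trans (sF _ _) _.
have G0 : 0 <= L0 + L1 * `|grad F x| by rewrite addr_ge0// mulr_ge0.
have Lh : L1 * `|x - (x + eta *: d)| <= L1 * eta by rewrite ler_wpM2l.
have L0h : 0 <= L1 * `|x - (x + eta *: d)| by rewrite mulr_ge0.
apply: ler_pM => //; first by rewrite mulr_ge0// expm1_ratio_ge0.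
apply: ler_wpM2l => //; apply: le_trans (expm1_ratio_le _) _.
  by rewrite L0h (le_lt_trans Lh).
by rewrite lef_pV2 ?posrE ?subr_gt0 ?(le_lt_trans Lh)// lerB.
Qed.

(** The minimising direction pairs with $m$ to at most $-\|m\|$; passing from
    $m$ to the gradient costs the estimation error twice, once in the pairing
    and once in the norm, and the curvature term comes from [smooth_descent]. *)
Lemma normalised_step_descent (F : B -> R) (L0 L1 eta : R) (x d : B)
    (m : dual_space B) :
  0 <= L0 -> 0 <= L1 -> 0 <= eta -> L0L1_smooth F L0 L1 -> L1 * eta < 1 ->
  is_argmin_ball m d ->
  eta * `|grad F x| <= F x - F (x + eta *: d) + 2 * eta * `|m - grad F x| +
    (L0 + L1 * `|grad F x|) * (1 - L1 * eta)^-1 / 2 * eta ^+ 2.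
Proof.
move=> L00 L10 e0 sF c1 md.
have [d1 _] := md.
have hx : `|eta *: d| <= eta by rewrite normrZ ger0_norm// ler_piMr.
have Lh : L1 * `|eta *: d| <= L1 * eta by rewrite ler_wpM2l.
have G0 : 0 <= L0 + L1 * `|grad F x| by rewrite addr_ge0// mulr_ge0.
have D := smooth_descent x L00 L10 sF (le_lt_trans Lh c1).
have C : (L0 + L1 * `|grad F x|) * (1 - L1 * `|eta *: d|)^-1 / 2 *
    `|eta *: d| ^+ 2 <=
  (L0 + L1 * `|grad F x|) * (1 - L1 * eta)^-1 / 2 * eta ^+ 2.
  rewrite -!mulrA; apply: ler_wpM2l => //; apply: ler_pM => //.
  - by rewrite invr_ge0 subr_ge0 ltW// (le_lt_trans Lh).
  - by rewrite lef_pV2 ?posrE ?subr_gt0 ?(le_lt_trans Lh)// lerB.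
  - by rewrite ler_wpM2l// lerXn2r ?nnegrE.
have gd : grad F x d <= - `|grad F x| + 2 * `|m - grad F x|.
  have h1 := argmin_ball_le md.
  have h2 : - (m - grad F x) d <= `|m - grad F x|.
    apply: le_trans (ler_norm _) _.
    by rewrite normrN; exact: dual_apply_le1.
  have h3 : `|grad F x| <= `|m| + `|m - grad F x|.
    by rewrite -[X in `|X| <= _](subKr m) (le_trans (ler_normB _ _)).
  rewrite dual_applyB in h2; clear - h1 h2 h3; lra.
have {}gd := ler_wpM2l e0 gd.
rewrite dualZ in D; clear - D C gd; lra.
Qed.

End SmoothDescent.

(** * Strong measurability and moments *)

Section StrongMeasurability.
Context (R : realType) d (T : measurableType d).
Implicit Types (V W U : normedModType R).

Lemma simple_map_measurable V (s : T -> V) (A : set V) :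
  simple_map measurable s -> measurable (s @^-1` A).
Proof.
move=> [fs ms]; rewrite (_ : _ @^-1` _ =
    \bigcup_(v in range s `&` A) (s @^-1` [set v])).
  by apply: fin_bigcup_measurable => // ; exact: finite_setIl.
apply/seteqP; split=> [w /= Aw|w [v [_ Av] /= ->//]].
by exists (s w) => //; split => //; exists w.
Qed.

Lemma simple_map_comp2 V W U (h : V -> W -> U) (s : T -> V) (t : T -> W) :
  simple_map measurable s -> simple_map measurable t ->
  simple_map measurable (fun w => h (s w) (t w)).
Proof.
move=> ss st; split.
  apply: (sub_finite_set (B := [set h x y | x in range s & y in range t])).
    by move=> _ [w _ <-]; exists (s w); [exists w|exists (t w) => //; exists w].
  by apply: finite_image2; [case: ss|case: st].
move=> u; rewrite (_ : _ @^-1` _ = \bigcup_(v in range s)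
    (s @^-1` [set v] `&` t @^-1` (h v @^-1` [set u]))).
  apply: fin_bigcup_measurable; first by case: ss.
  by move=> v _; apply: measurableI; exact: simple_map_measurable.
apply/seteqP; split=> [w /= hw|w [v _ /= [-> ->//]]].
by exists (s w) => //; exists w.
Qed.

Lemma simple_map_cst V (v : V) : simple_map measurable (fun _ : T => v).
Proof.
split; first by apply: (sub_finite_set (B := [set v])) => // _ [w _ <-].
move=> u; have [->|uv] := eqVneq u v.
  by rewrite (_ : _ @^-1` _ = setT)//; apply/seteqP; split.
rewrite (_ : _ @^-1` _ = set0)//; apply/seteqP; split => // w /= vu.
by rewrite vu eqxx in uv.
Qed.

Lemma strongly_measurable_cst V (v : V) :
  strongly_measurable measurable (fun _ : T => v).
Proof.
exists (fun _ _ => v) => [n|w]; first exact: simple_map_cst.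
exact: cvg_cst.
Qed.

Lemma strongly_measurable_comp2 V W U (h : V -> W -> U)
    (f : T -> V) (g : T -> W) :
  continuous (fun z : V * W => h z.1 z.2) ->
  strongly_measurable measurable f -> strongly_measurable measurable g ->
  strongly_measurable measurable (fun w => h (f w) (g w)).
Proof.
move=> ch [s ss sf] [t st tg].
exists (fun n w => h (s n w) (t n w)) => [n|w]; first exact: simple_map_comp2.
apply: (continuous2_cvg _ _ (sf w) (tg w)).
exact: (ch (f w, g w)).
Qed.

Lemma strongly_measurable_comp V W (h : V -> W) (f : T -> V) :
  continuous h -> strongly_measurable measurable f ->
  strongly_measurable measurable (h \o f).
Proof.
move=> ch mf; apply: (strongly_measurable_comp2 (h := fun v _ => h v) _ mf mf).
by move=> z; apply: (@continuous_comp _ _ _ fst h); [exact: cvg_fst|exact: ch].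
Qed.

Lemma strongly_measurableD V (f g : T -> V) :
  strongly_measurable measurable f -> strongly_measurable measurable g ->
  strongly_measurable measurable (fun w => f w + g w).
Proof. by apply: strongly_measurable_comp2 => z; exact: add_continuous. Qed.

Lemma strongly_measurableZ V (a : R) (f : T -> V) :
  strongly_measurable measurable f ->
  strongly_measurable measurable (fun w => a *: f w).
Proof. by apply: strongly_measurable_comp => z; exact: scaler_continuous. Qed.

Lemma strongly_measurableB V (f g : T -> V) :
  strongly_measurable measurable f -> strongly_measurable measurable g ->
  strongly_measurable measurable (fun w => f w - g w).
Proof.
move=> mf mg; apply: strongly_measurableD => //.
by under eq_fun do rewrite -scaleN1r; exact: strongly_measurableZ.
Qed.

Lemma strongly_measurable_real V (h : V -> R) (f : T -> V) :
  continuous h -> strongly_measurable measurable f ->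
  measurable_fun setT (h \o f).
Proof.
move=> ch [s ss sf].
apply: (@measurable_fun_cvg _ _ _ _ (fun n => h \o s n)) => [n|w _ /=].
  by move=> _ A mA; rewrite setTI comp_preimage; exact: simple_map_measurable.
by apply: (cvg_comp _ _ (sf w)); exact: ch.
Qed.

Lemma strongly_measurable_norm V (f : T -> V) :
  strongly_measurable measurable f -> measurable_fun setT (fun w => `|f w|).
Proof. by apply: strongly_measurable_real => v; exact: norm_continuous. Qed.

Lemma strongly_measurable_norm_powR V (f : T -> V) (r : R) :
  strongly_measurable measurable f ->
  measurable_fun setT (fun w => (`|f w| `^ r)%:E).
Proof.
move=> mf; apply/measurable_EFinP.
apply: (measurableT_comp (f := fun x : R => x `^ r)); first exact: measurable_powR.
exact: strongly_measurable_norm.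
Qed.

End StrongMeasurability.

Lemma strongly_measurable_precomp (R : realType) (V : normedModType R)
    d d' (T : measurableType d) (T' : measurableType d')
    (f : T' -> V) (phi : T -> T') :
  measurable_fun setT phi -> strongly_measurable measurable f ->
  strongly_measurable measurable (f \o phi).
Proof.
move=> mphi [s ss sf]; exists (fun n => s n \o phi) => [n|w].
  split=> [|v]; last by rewrite comp_preimage -[X in measurable X]setTI;
    apply: mphi => //; exact: (ss n).2.
  by apply: sub_finite_set (ss n).1 => _ [w _ <-]; exists (phi w).
exact: sf.
Qed.

Section Moments.
Context (R : realType) d (T : measurableType d) (P : probability T R).

Lemma expectationE (X : T -> R) : 'E_P[X]%E = (\int[P]_w (X w)%:E)%E.
Proof. by rewrite unlock. Qed.

Lemma integral_cst_probability (c : R) : (\int[P]_w (c%:E) = c%:E)%E.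
Proof. by have := expectation_cst P c; rewrite unlock. Qed.

Lemma ge0_integral_affine (X : T -> R) (a b : R) :
  measurable_fun setT X -> (forall w, 0 <= X w) -> 0 <= a -> 0 <= b ->
  (\int[P]_w (a * X w + b)%:E = a%:E * \int[P]_w (X w)%:E + b%:E)%E.
Proof.
move=> mX X0 a0 b0; under eq_integral do rewrite EFinD EFinM.
have mX' : measurable_fun setT (fun w => (X w)%:E) by exact/measurable_EFinP.
rewrite ge0_integralD//=.
- rewrite ge0_integralZl ?lee_fin//; last by move=> w _; rewrite lee_fin.
  by congr (_ + _)%E; exact: integral_cst_probability.
- by move=> w _; rewrite mule_ge0// lee_fin.
- exact: measurable_funeM.
Qed.

(** Integrate the tangent to the concave function $z\mapsto z^{r/s}$ at $c^s$. *)
Lemma moment_le (X : T -> R) (r s c : R) :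
  measurable_fun setT X -> (forall w, 0 <= X w) -> 0 < r <= s -> 0 < c ->
  (\int[P]_w (X w `^ s)%:E <= (c `^ s)%:E)%E ->
  (\int[P]_w (X w `^ r)%:E <= (c `^ r)%:E)%E.
Proof.
move=> mX X0 rs c0 h; have [r0 rs'] := andP rs.
have s0 : 0 < s := lt_le_trans r0 rs'.
have mXp (p : R) : measurable_fun setT (fun w => X w `^ p).
  by apply: (measurableT_comp (f := fun x : R => x `^ p)) => //; exact: measurable_powR.
pose a := r / s * c `^ (r - s); pose b := (1 - r / s) * c `^ r.
have a0 : 0 <= a by rewrite mulr_ge0 ?powR_ge0// divr_ge0 ?ltW.
have b0 : 0 <= b.
  by rewrite mulr_ge0 ?powR_ge0// subr_ge0 ler_pdivrMr// mul1r.
apply: (@le_trans _ _ (\int[P]_w (a * X w `^ s + b)%:E)%E).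
  apply: ge0_le_integral => //.
  - by move=> w _; rewrite lee_fin powR_ge0.
  - exact/measurable_EFinP.
  - apply/measurable_EFinP; apply: measurable_funD => //.
    exact: measurable_funM.
  - move=> w _; rewrite lee_fin.
    by apply: le_trans (powR_le_tangent rs (X0 w) c0) _; rewrite /a /b mulrAC.
rewrite ge0_integral_affine//; last by move=> w; exact: powR_ge0.
apply: le_trans (leeD2r _ (lee_wpmul2l _ h)) _; first by rewrite lee_fin.
rewrite -EFinM -EFinD lee_fin /a /b -[r / s * _ * _]mulrA -powRD ?subrK; last first.
  by rewrite (gt_eqF c0) implybT.
by rewrite -mulrDl addrCA subrr addr0 mul1r.
Qed.

End Moments.

(** * Bochner means under continuous functionals *)

Section BochnerMean.
Context (R : realType) d (T : measurableType d) (P : probability T R).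

Lemma simple_map_indic (V : normedModType R) (s : T -> V) (h : V -> R) w :
  finite_set (range s) ->
  h (s w) = \sum_(v <- fset_set (range s)) h v * \1_(s @^-1` [set v]) w.
Proof.
move=> fs; rewrite (bigD1_seq (s w)) ?fset_uniq//=; last first.
  by rewrite in_fset_set// inE; exists w.
rewrite indicE mem_set// mulr1 big1 ?addr0// => v vs.
by rewrite indicE memNset ?mulr0//= => sv; rewrite sv eqxx in vs.
Qed.

Lemma simple_map_integral (V : normedModType R) (s : T -> V) (h : V -> R) :
  simple_map measurable s ->
  P.-integrable setT (fun w => (h (s w))%:E) /\
  (\int[P]_w (h (s w))%:E =
    (\sum_(v <- fset_set (range s)) h v * fine (P (s @^-1` [set v])))%:E)%E.
Proof.
move=> [fs ms].
have E : (fun w => (h (s w))%:E) = (fun w =>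
    (\sum_(v <- fset_set (range s)) (h v)%:E * (\1_(s @^-1` [set v]) w)%:E)%E).
  by apply/funext => w; rewrite (simple_map_indic h w fs) -sumEFin.
have I v : P.-integrable setT (fun w => (\1_(s @^-1` [set v]) w)%:E).
  apply: (@le_integrable _ _ _ _ _ measurableT _ (EFin \o cst 1)).
  - by apply/measurable_EFinP; exact: measurable_indic.
  - by move=> w _; rewrite /= lee_fin normr1 ger0_norm ?indicE//; case: (_ \in _).
  - exact: finite_measure_integrable_cst.
rewrite E; split.
  by apply: integrable_sum => // v _; exact: integrableZl.
rewrite integral_sum//; last by move=> v; exact: integrableZl.
rewrite -sumEFin; apply: eq_bigr => v _.
rewrite integralZl// integral_indic// setIT EFinM fineK//.
exact: fin_num_measure.
Qed.

Lemma simple_mean_apply (B : normedModType R) (s : T -> dual_space B) (u : B) :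
  simple_map measurable s ->
  (\int[P]_w (s w u)%:E = (simple_mean P s u)%:E)%E.
Proof.
move=> ss; have [_ ->] := simple_map_integral (fun f : dual_space B => f u) ss.
congr _%:E; rewrite /simple_mean fsbig_finite; last by case: ss.
rewrite (big_morph (fun f : dual_space B => f u) (id1 := 0) (op1 := +%R))//.
by apply: eq_bigr => v _; rewrite dual_applyZ mulrC.
Qed.

Lemma dual_eval_continuous (B : normedModType R) (u : B) :
  continuous (fun f : dual_space B => f u : R).
Proof.
move=> f A /nbhs_normP[e /= e0 hA]; apply/nbhs_normP.
have u1 : 0 < `|u| + 1 by rewrite ltr_wpDl.
exists (e / (`|u| + 1)) => /=; first by rewrite divr_gt0.
move=> g /=; rewrite ltr_pdivlMr// => h; apply: hA => /=.
rewrite -dual_applyB (le_lt_trans (dual_apply_le _ _))// (le_lt_trans _ h)//.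
by rewrite ler_wpM2l// lerDl.
Qed.

(** For simple maps, evaluation at $u$ commutes with the mean by linearity; in
    the limit the error is at most $\|u\|$ times the mean distance. *)
Lemma bochner_mean_apply (B : normedModType R) (f : T -> dual_space B)
    (v : dual_space B) (u : B) :
  has_bochner_mean P f v ->
  P.-integrable setT (fun w => (f w u)%:E) /\
  (\int[P]_w (f w u)%:E = (v u)%:E)%E.
Proof.
move=> [mf [s [ss sf sv]]].
pose D n w : R := `|f w - s n w|.
have D0 n w : 0 <= D n w by exact: normr_ge0.
have sms n : strongly_measurable measurable (s n).
  by exists (fun=> s n) => // w; exact: cvg_cst.
have mD n : measurable_fun setT (D n).
  by apply: strongly_measurable_norm; exact: strongly_measurableB.
have mfu : measurable_fun setT (fun w => f w u).
  exact: (strongly_measurable_real (@dual_eval_continuous B u)).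
have sD : (fun n => \int[P]_w (D n w)%:E)%E @ \oo --> 0%E.
  by move: sf; under eq_fun do rewrite expectationE.
have fin : \forall n \near \oo, P.-integrable setT (EFin \o D n).
  have [+ _] := (fine_cvgP _ _).1 sD.
  apply: filterS => n h; apply/integrableP; split.
    exact/measurable_EFinP.
  under eq_integral do rewrite /= ger0_norm ?normr_ge0//.
  by move/fin_numPlt: h => /andP[_].
have isu n : P.-integrable setT (EFin \o (fun w => s n w u)).
  by have [] := simple_map_integral (fun g : dual_space B => g u) (ss n).
have ifu : P.-integrable setT (EFin \o (fun w => f w u)).
  have [n iD] : exists n, P.-integrable setT (EFin \o D n).
    by have [N _ /(_ N (leqnn N))] := fin; exists N.
  have := integrableD measurableT (integrableZl measurableT `|u| iD)
    (integrable_norm (isu n)).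
  apply: le_integrable => //; first exact/measurable_EFinP.
  move=> w _; rewrite /= lee_fin [leRHS]ger0_norm; last first.
    by rewrite addr_ge0// mulr_ge0.
  rewrite mulrC -[X in `|X| <= _](subrK (s n w u)) (le_trans (ler_normD _ _))//.
  by rewrite lerD2r -dual_applyB dual_apply_le.
split=> //; pose L := \int[P]_w (f w u).
have LE : (\int[P]_w (f w u)%:E = L%:E)%E.
  by rewrite /L /Rintegral fineK// integrable_fin_num.
rewrite LE; congr _%:E.
have meanE n : simple_mean P (s n) u = \int[P]_w (s n w u).
  by rewrite /Rintegral simple_mean_apply.
have c1 : (fun n => simple_mean P (s n) u) @ \oo --> v u.
  exact: (cvg_comp _ _ sv (@dual_eval_continuous B u v)).
have c2 : (fun n => simple_mean P (s n) u) @ \oo --> L.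
  have sD' : (fun n => `|u| * \int[P]_w (D n w)) @ \oo --> 0.
    rewrite -(mulr0 `|u|); apply: cvgMr; exact: fine_cvg sD.
  apply/cvgrPdist_le => e e0.
  have hn : \forall n \near \oo, `|0 - `|u| * \int[P]_w (D n w)| <= e.
    by move/cvgrPdist_le : sD'; apply.
  near=> n; rewrite meanE /L.
  have iD : P.-integrable setT (EFin \o D n) by near: n; exact: fin.
  rewrite -RintegralB//.
  apply: le_trans (le_normr_Rintegral _ _) _ => //.
    exact: (integrableB measurableT ifu (isu n)).
  have : `|0 - `|u| * \int[P]_w (D n w)| <= e by near: n.
  rewrite sub0r normrN => /(le_trans (ler_norm _)); apply: le_trans.
  rewrite -RintegralZl//; apply: le_Rintegral => //.
  - exact: integrable_norm (integrableB measurableT ifu (isu n)).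
  - exact: (integrableZl measurableT `|u| iD).
  - by move=> w _; rewrite -dual_applyB mulrC dual_apply_le.
exact: (cvg_unique _ c2 c1).
Unshelve. all: by end_near. Qed.

End BochnerMean.

(** * Independence of a fresh sample from the past *)

Section Independence.
Context (R : realType) d d' (T : measurableType d) (X : measurableType d')
  (P : probability T R) (xi0 : {RV P >-> X}) (xi : nat -> {RV P >-> X}).
Hypothesis xi_ind : independent_copies xi0 xi.

Definition history_gen (n : nat) : set (set T) :=
  \bigcup_(i in [set i | (1 <= i <= n)%N])
    preimage_set_system setT (xi i) measurable.

(** Measurability with respect to the first $n$ samples becomes measurability
    on a measurable type of its own, to which product measures and the
    measurability of the oracle apply. *)
Definition history_space (n : nat) := g_sigma_algebraType (history_gen n).

Lemma sample_measurable n i : (1 <= i <= n)%N ->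
  measurable_fun setT (xi i : history_space n -> X).
Proof.
move=> i1n _ A mA; apply: sub_sigma_algebra; exists i => //.
by exists A.
Qed.

Lemma history_sub_measurable n (A : set T) :
  history xi n A -> measurable A.
Proof.
apply: smallest_sub; first exact: sigma_algebra_measurable.
move=> _ [i _ [C mC <-]]; rewrite setTI; exact: measurable_funPTI.
Qed.

Lemma history_id_measurable n :
  measurable_fun setT (id : T -> history_space n).
Proof. by move=> _ A mA; rewrite setTI; exact: (@history_sub_measurable n). Qed.

Lemma strongly_measurable_history (V : normedModType R) n
    (f : history_space n -> V) :
  strongly_measurable measurable f ->
  strongly_measurable measurable (f : T -> V).
Proof. exact: strongly_measurable_precomp (@history_id_measurable n). Qed.

Lemma history_mono m n : (m <= n)%N -> history xi m `<=` history xi n.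
Proof.
move=> mn; apply: sub_smallest2r; first exact: smallest_sigma_algebra.
move=> C [i /andP[i1 im] H]; exists i => //.
by apply/andP; split=> //; exact: leq_trans mn.
Qed.

Lemma history_space_mono m n : (m <= n)%N ->
  measurable_fun setT (id : history_space n -> history_space m).
Proof. by move=> mn _ A mA; rewrite setTI; exact: history_mono mn _ mA. Qed.

(** Finite intersections of preimages form a generating $\pi$-system of the
    history, on which the product rule is the definition of independence. *)
Lemma history_independent n (E : set T) (A : set X) :
  history xi n E -> measurable A ->
  P (E `&` xi n.+1 @^-1` A) = (P E * P (xi n.+1 @^-1` A))%E.
Proof.
move=> HE mA; set C := xi n.+1 @^-1` A.
have mxi i (B : set X) : measurable B -> measurable (xi i @^-1` B).
  exact: measurable_funPTI.
have mC : measurable C by exact: mxi.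
pose J := [fset i in iota 1 n]%fset.
have inJ i : (i \in J) = (1 <= i <= n)%N by rewrite !inE mem_iota add1n ltnS.
pose rect : set (set T) := [set E | exists B : nat -> set X,
  (forall t, measurable (B t)) /\ E = \bigcap_(t in [set` J]) xi t @^-1` B t].
have rectI : setI_closed rect.
  move=> _ _ [B1 [mB1 ->]] [B2 [mB2 ->]]; exists (fun t => B1 t `&` B2 t).
  by split=> [t|]; [exact: measurableI|rewrite -bigcapI].
pose H : set (set T) := [set E | measurable E /\ P (E `&` C) = (P E * P C)%E].
have PCfin : P C \is a fin_num by exact: fin_num_measure.
have Hd : dynkin H.
  split.
  - split; first exact: measurableT.
    by rewrite setTI probability_setT mul1e.
  - move=> B [mB hB]; split; first exact: measurableC.
    have PBfin : P B \is a fin_num by exact: fin_num_measure.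
    have : P C = (P (C `\` B) + P (C `&` B))%E by rewrite -measureDI.
    rewrite setDE [C `&` ~` B]setIC [C `&` B]setIC hB.
    rewrite probability_setC//; move: PCfin PBfin.
    have : P (~` B `&` C) \is a fin_num.
      by apply: fin_num_measure; apply: measurableI => //; exact: measurableC.
    case: (P (~` B `&` C)) => // a _; case: (P C) => // b _; case: (P B) => // c _.
    rewrite -!EFinB -!EFinM -!EFinD => -[hb]; congr _%:E; lra.
  - move=> F tF hF; have mF i : measurable (F i) by case: (hF i).
    split; first exact: bigcupT_measurable.
    have hU : (P (\bigcup_i F i `&` C) =
        \sum_(0 <= i <oo | i \in setT) P (F i `&` C))%E.
      exact: (@measure_bigcup _ _ _ (mrestr P mC) setT F (fun i _ => mF i) tF).
    rewrite hU measure_bigcup//.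
    rewrite -(fineK PCfin) muleC -nneseriesZl//.
    by apply: eq_eseriesr => i _; rewrite fineK// muleC; case: (hF i).
have rectH : rect `<=` H.
  move=> _ [B [mB ->]]; split.
    by apply: fin_bigcap_measurable => // i _; exact: mxi.
  have J0 : 0%N \notin J by rewrite inJ.
  have nJ : n.+1 \notin J by rewrite inJ /= ltnn.
  pose B' t := if t == n.+1 then A else B t.
  have mB' t : measurable (B' t) by rewrite /B'; case: ifP.
  have B'J t : t \in J -> B' t = B t.
    by rewrite /B' => tJ; case: eqP => // tn; rewrite -tn tJ in nJ.
  have [_ ind] := xi_ind.
  have J'0 : 0%N \notin (n.+1 |` J)%fset by rewrite in_fset1U negb_or J0.
  have := ind (n.+1 |` J)%fset B' J'0 mB'.
  have B'n : B' n.+1 = A by rewrite /B' eqxx.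
  rewrite big_fsetU1// B'n -/C.
  rewrite (_ : \bigcap_(t in [set` (n.+1 |` J)%fset]) xi t @^-1` B' t =
    (\bigcap_(t in [set` J]) xi t @^-1` B t) `&` C); last first.
    apply/seteqP; split=> [w hw|w [hw Cw] t /=].
      split=> [t /= tJ|]; last first.
        by have := hw n.+1; rewrite /= in_fset1U eqxx B'n; apply.
      by have := hw t; rewrite /= in_fset1U tJ orbT B'J//; apply.
    rewrite in_fset1U => /predU1P[->|tJ]; first by rewrite B'n.
    by rewrite B'J//; exact: hw.
  move=> ->; rewrite (ind J B J0 mB) muleC; congr (_ * _)%E.
  by rewrite big_seq [RHS]big_seq; apply: eq_bigr => t tJ; rewrite B'J.
have gen_rect : history_gen n `<=` rect.
  move=> _ [i /= i1n [B mB <-]]; rewrite setTI.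
  exists (fun t => if t == i then B else setT); split=> [t|].
    by case: ifP => // _; exact: measurableT.
  apply/seteqP; split=> [w Bw t _ /=|w /(_ i)/=]; first by case: eqP => // ->.
  by rewrite eqxx; apply; rewrite inJ.
have : <<s setT, rect >> `<=` H.
  by apply: lambda_system_subset => //; exact/dynkin_lambda_system.
move=> /(_ E)[]//; apply: (sub_smallest2r _ gen_rect) HE.
exact: smallest_sigma_algebra.
Qed.

Let history_rv n : {RV P >-> history_space n} :=
  HB.pack (id : T -> history_space n)
    (isMeasurableFun.Build _ _ _ _ (id : T -> history_space n)
      (@history_id_measurable n)).

Let pair_measurable n :
  measurable_fun setT (fun w => (w, xi n.+1 w) : history_space n * X).
Proof.
apply: measurable_fun_pair; first exact: history_id_measurable.
exact: measurable_funPT.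
Qed.

Let pair_rv n : {RV P >-> (history_space n * X)%type} :=
  HB.pack (fun w => (w, xi n.+1 w) : history_space n * X)
    (isMeasurableFun.Build _ _ _ _
      (fun w => (w, xi n.+1 w) : history_space n * X) (@pair_measurable n)).

(** The joint law of the past and a fresh sample is a product measure, so the
    fresh sample may be integrated out first with the past held fixed; this
    replaces conditional expectations. *)
Lemma fresh_sample_fubini n (phi : history_space n * X -> \bar R) :
  measurable_fun setT phi -> (forall z, (0 <= phi z)%E) ->
  (\int[P]_w phi (w, xi n.+1 w) =
   \int[P]_w \int[P]_w' phi (w, xi0 w'))%E.
Proof.
move=> mphi phi0.
have [dist _] := xi_ind.
pose mu1 := distribution P (history_rv n); pose mu2 := distribution P xi0.
transitivity (\int[distribution P (pair_rv n)]_z phi z)%E.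
  by rewrite ge0_integral_distribution.
transitivity (\int[(mu1 \x mu2)%E]_z phi z)%E.
  apply: eq_measure_integral => A mA _.
  apply/esym; apply: product_measure_unique => // {mA}A C mA mC.
  apply: etrans (history_independent mA mC) _; congr (_ * _)%E.
  exact: dist.
rewrite fubini_tonelli1// /fubini_F ge0_integral_distribution//=.
- apply: eq_integral => w _.
  rewrite ge0_integral_distribution//.
  exact: (measurable_fun_pair2 _ mphi).
- exact: measurable_fun_fubini_tonelli_F.
- by move=> w; exact: integral_ge0.
Qed.

Lemma fresh_integral_measurable n (phi : history_space n * X -> \bar R) :
  measurable_fun setT phi -> (forall z, (0 <= phi z)%E) ->
  measurable_fun setT (fun w : T => \int[P]_w' phi (w, xi0 w'))%E.
Proof.
move=> mphi phi0.
have h := measurable_fun_fubini_tonelli_F (m2 := distribution P xi0)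
  phi mphi phi0.
have h' := measurable_comp measurableT (@subsetT _ _) h
  (@history_id_measurable n).
apply: (eq_measurable_fun _ _ h') => w _ /=; rewrite /fubini_F.
rewrite ge0_integral_distribution//.
exact: (measurable_fun_pair2 _ mphi).
Qed.

End Independence.

(** * The noise of the oracle *)

Section NoiseStep.
Context (R : realType).

Lemma integral_affine2 d (T : measurableType d) (P : probability T R)
    (X Y : T -> R) (a b c : R) :
  P.-integrable setT (EFin \o X) -> P.-integrable setT (EFin \o Y) ->
  (\int[P]_w (a + b * X w + c * Y w)%:E =
    (a + b * \int[P]_w X w + c * \int[P]_w Y w)%:E)%E.
Proof.
move=> iX iY.
have ibX := integrableZl measurableT b iX.
have icY := integrableZl measurableT c iY.
have ia := finite_measure_integrable_cst P a measurableT.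
under eq_integral do rewrite EFinD EFinD !EFinM.
rewrite (integralD measurableT (integrableD measurableT ia ibX) icY).
rewrite (integralD measurableT ia ibX) !integralZl//.
rewrite (integral_cst_probability P a) !EFinD !EFinM /Rintegral.
by rewrite !fineK ?integrable_fin_num.
Qed.

(** Adding a centred term $cD$ to a fixed $f$: smoothness bounds
    $\|f+cD\|^r+\|f-cD\|^r$, and $\mathbb E\|f-cD\|^r\ge\|f\|^r$ because
    $\|f-cD\|$ dominates its value at an almost norming vector of $f$, whose
    mean is almost $\|f\|$. *)
Lemma mean_zero_step (B : normedModType R) d (T : measurableType d)
    (P : probability T R) (r K S c : R) (D : T -> dual_space B)
    (f : dual_space B) :
  1 <= r -> 0 <= K -> 0 <= c ->
  (forall f g : dual_space B,
    `|f + g| `^ r + `|f - g| `^ r <= 2 * (`|f| `^ r + (K * `|g|) `^ r)) ->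
  strongly_measurable measurable D ->
  (forall u, P.-integrable setT (fun w => (D w u)%:E) /\
    (\int[P]_w (D w u)%:E = 0)%E) ->
  (\int[P]_w (`|D w| `^ r)%:E <= S%:E)%E ->
  (\int[P]_w (`|f + c *: D w| `^ r)%:E <=
    (`|f| `^ r + 2 * (K * c) `^ r * S)%:E)%E.
Proof.
move=> r1 K0 c0 sm mD D0 DS.
have mDr : measurable_fun setT (fun w => (`|D w| `^ r)%:E).
  exact: strongly_measurable_norm_powR.
have iD : P.-integrable setT (EFin \o (fun w => `|D w| `^ r)).
  apply/integrableP; split => //.
  under eq_integral do rewrite /= ger0_norm ?powR_ge0//.
  exact: le_lt_trans DS (ltry _).
have DS' : \int[P]_w (`|D w| `^ r) <= S.
  by rewrite -lee_fin /Rintegral fineK// integrable_fin_num.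
pose a := `|f|; pose k := r * a `^ (r - 1).
have k0 : 0 <= k by rewrite mulr_ge0 ?powR_ge0// (le_trans ler01).
apply/lee_addgt0Pr => e e0.
have e'0 : 0 < e / (k + 1) by rewrite divr_gt0// ltr_wpDl.
have [u u1 hu] := dual_almost_norming f e'0.
have [iDu Du0] := D0 u.
pose A := a `^ r + k * (a - f u).
pose b := 2 * (K * c) `^ r.
have b0 : 0 <= b by rewrite mulr_ge0// powR_ge0.
have pw w : `|f + c *: D w| `^ r <= A + b * `|D w| `^ r + k * c * D w u.
  have h1 := sm f (c *: D w).
  have h2 : a `^ r + k * (`|f - c *: D w| - a) <= `|f - c *: D w| `^ r.
    exact: (powR_ge_tangent r1 (normr_ge0 _) (normr_ge0 _)).
  have h3 : f u - c * D w u <= `|f - c *: D w|.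
    rewrite -dual_applyZ -dual_applyB.
    exact: le_trans (ler_norm _) (dual_apply_le1 _ u1).
  have h4 : (K * `|c *: D w|) `^ r = (K * c) `^ r * `|D w| `^ r.
    by rewrite normrZ ger0_norm// mulrA powRM// mulr_ge0.
  have h5 := ler_wpM2l k0 h3.
  rewrite h4 in h1; rewrite /A /b -/a in h1 *.
  have comb (l n z ar Kc x v fu k' a' : R) : l + n <= 2 * (ar + Kc * x) ->
      ar + k' * (z - a') <= n -> k' * (fu - c * v) <= k' * z ->
      l <= ar + k' * (a' - fu) + 2 * Kc * x + k' * c * v by clear; lra.
  exact: comb h1 h2 h5.
have mfD : strongly_measurable measurable (fun w => f + c *: D w).
  by apply: strongly_measurableD; [exact: strongly_measurable_cst|
     exact: strongly_measurableZ].
apply: (@le_trans _ _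
  (\int[P]_w (A + b * `|D w| `^ r + k * c * D w u)%:E)%E).
  apply: ge0_le_integral => //.
  - exact: strongly_measurable_norm_powR.
  - apply/measurable_EFinP; apply: measurable_funD.
      by apply: measurable_funD => //; apply: measurable_funM => //; exact/measurable_EFinP.
    apply: measurable_funM => //; apply/measurable_EFinP.
    exact: measurable_int iDu.
  - by move=> w _; rewrite lee_fin.
rewrite integral_affine2// {2}/Rintegral Du0 /= mulr0 addr0 -EFinD lee_fin.
have h6 : k * (a - f u) <= e.
  apply: le_trans (_ : k * (e / (k + 1)) <= _).
    rewrite ler_wpM2l// /a; move: hu; clear; lra.
  rewrite mulrCA ler_piMr ?(ltW e0)// ler_pdivrMr ?ltr_wpDl// mul1r lerDl//.
have h7 := ler_wpM2l b0 DS'.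
rewrite /A -/a -/b; move: h6 h7; clear; lra.
Qed.

Lemma L0L1_smooth_continuous (B : normedModType R) (F : B -> R) (L0 L1 : R) :
  0 <= L0 -> 0 <= L1 -> L0L1_smooth F L0 L1 -> continuous (grad F).
Proof.
move=> L00 L10 [_ sF] x A /nbhs_normP[e /= e0 hA]; apply/nbhs_normP.
pose c := L0 + L1 * `|grad F x|.
have c0 : 0 <= c by rewrite addr_ge0// mulr_ge0.
have c1 : 0 < 2 * c + 1 by rewrite ltr_wpDl// mulr_ge0.
have l1 : 0 < 2 * L1 + 1 by rewrite ltr_wpDl// mulr_ge0.
exists (Num.min (2 * L1 + 1)^-1 (e / (2 * c + 1))).
  by rewrite /= lt_min invr_gt0 l1 divr_gt0.
move=> y /=; rewrite lt_min => /andP[h1 h2]; apply: hA => /=.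
apply: le_lt_trans (sF _ _) _; rewrite -/c.
have d0 : 0 <= `|x - y| by [].
have h3 : L1 * `|x - y| <= 2^-1.
  have := ler_wpM2l (ltW l1) (ltW h1); rewrite mulfV ?gt_eqF//.
  by move: d0; clear; lra.
have h4 : expm1_ratio (L1 * `|x - y|) <= 2.
  apply: le_trans (expm1_ratio_le _) _.
    by rewrite mulr_ge0//= (le_lt_trans h3)//; clear; lra.
  rewrite -[leRHS]invrK lef_pV2 ?posrE//; first by move: h3; clear; lra.
  by move: h3; clear; lra.
rewrite ltr_pdivlMr// in h2; apply: le_lt_trans h2.
have := ler_wpM2r d0 (ler_wpM2l c0 h4).
move: d0; clear; lra.
Qed.

Section Oracle.
Context (B : normedModType R) (F : B -> R) d d' (T : measurableType d)
  (X : measurableType d') (P : probability T R) (xi0 : {RV P >-> X})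
  (xi : nat -> {RV P >-> X}) (g : B -> X -> dual_space B)
  (p r K sigma : R).
Hypotheses (r1 : 1 <= r) (rp : r <= p) (K0 : 0 <= K) (sigma0 : 0 < sigma).
Hypothesis smooth : forall f g : dual_space B,
  `|f + g| `^ r + `|f - g| `^ r <= 2 * (`|f| `^ r + (K * `|g|) `^ r).
Hypothesis grad_cont : continuous (grad F).
Hypothesis g_meas : oracle_measurable g.
Hypothesis g_mean :
  forall y, has_bochner_mean P (fun w => g y (xi0 w)) (grad F y).
Hypothesis g_moment : forall y,
  ('E_P[(fun w => `|g y (xi0 w) - grad F y| `^ p)%R] <= (sigma `^ p)%:E)%E.
Hypothesis xi_ind : independent_copies xi0 xi.

Definition noise (y : B) (s : X) : dual_space B := g y s - grad F y.

Lemma noise_strongly_measurable d1 (S : measurableType d1)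
    (y : S -> B) (z : S -> X) :
  strongly_measurable measurable y -> measurable_fun setT z ->
  strongly_measurable measurable (fun w => noise (y w) (z w)).
Proof.
move=> my mz; apply: strongly_measurableB; first exact: g_meas.
exact: strongly_measurable_comp grad_cont my.
Qed.

Lemma noise_mean_zero y u :
  P.-integrable setT (fun w => (noise y (xi0 w) u)%:E) /\
  (\int[P]_w (noise y (xi0 w) u)%:E = 0)%E.
Proof.
have [ig Eg] := bochner_mean_apply u (g_mean y).
have ic := finite_measure_integrable_cst P (grad F y u) measurableT.
split; first exact: (integrableB measurableT ig ic).
under eq_integral do rewrite EFinB.
rewrite (integralB measurableT ig ic) Eg.
by rewrite (integral_cst_probability P) -EFinB subrr.
Qed.

Lemma noise_moment y s : 0 < s <= p ->
  (\int[P]_w (`|noise y (xi0 w)| `^ s)%:E <= (sigma `^ s)%:E)%E.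
Proof.
move=> sp; apply: (@moment_le _ _ _ _ (fun w => `|noise y (xi0 w)|) s p) => //.
  apply: strongly_measurable_norm.
  by apply: noise_strongly_measurable; [exact: strongly_measurable_cst|
     exact: measurable_funPT].
by have := g_moment y; rewrite expectationE.
Qed.

(** With the past held fixed, the point and $f$ are constants and the noise is
    centred. *)
Lemma fresh_noise_step n (f : history_space xi n -> dual_space B)
    (y : history_space xi n -> B) (c : R) :
  0 <= c -> strongly_measurable measurable f -> strongly_measurable measurable y ->
  (\int[P]_w (`|f w + c *: noise (y w) (xi n.+1 w)| `^ r)%:E <=
   \int[P]_w (`|f w| `^ r)%:E + (2 * (K * c) `^ r * sigma `^ r)%:E)%E.
Proof.
move=> c0 mf my.
have m1 := @measurable_fst _ _ (history_space xi n) X.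
have m2 := @measurable_snd _ _ (history_space xi n) X.
pose phi (z : history_space xi n * X) : \bar R :=
  (`|f z.1 + c *: noise (y z.1) z.2| `^ r)%:E.
have mphi : measurable_fun setT phi.
  apply: strongly_measurable_norm_powR; apply: strongly_measurableD.
    exact: strongly_measurable_precomp m1 mf.
  apply: strongly_measurableZ; apply: noise_strongly_measurable => //.
  exact: strongly_measurable_precomp m1 my.
have phi0 z : (0 <= phi z)%E by rewrite lee_fin powR_ge0.
rewrite [leLHS](fresh_sample_fubini xi_ind mphi phi0).
pose C := 2 * (K * c) `^ r * sigma `^ r.
have C0 : 0 <= C by rewrite !mulr_ge0// powR_ge0.
have mfr : measurable_fun setT (fun w : T => (`|f w| `^ r)%:E).
  apply: strongly_measurable_norm_powR.
  exact: strongly_measurable_history mf.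
rewrite [leRHS](_ : _ = \int[P]_w ((`|f w| `^ r)%:E + C%:E))%E; last first.
  rewrite ge0_integralD//.
  by rewrite (integral_cst_probability P).
have mF : measurable_fun setT (fun w : T => \int[P]_w' phi (w, xi0 w'))%E.
  exact: fresh_integral_measurable.
apply: ge0_le_integral => //.
- by move=> w _; exact: integral_ge0.
- exact: emeasurable_funD.
- move=> w _; rewrite -EFinD.
  apply: (@mean_zero_step B _ _ P r K (sigma `^ r) c
    (fun w' => noise (y w) (xi0 w')) (f w) r1 K0 c0 smooth).
  + by apply: noise_strongly_measurable; [exact: strongly_measurable_cst|
       exact: measurable_funPT].
  + exact: noise_mean_zero.
  + by apply: noise_moment; rewrite rp andbT (lt_le_trans ltr01 r1).
Qed.

Lemma fresh_noise_moment n (y : history_space xi n -> B) :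
  strongly_measurable measurable y ->
  (\int[P]_w (`|noise (y w) (xi n.+1 w)|)%:E <= sigma%:E)%E.
Proof.
move=> my; pose phi (z : history_space xi n * X) : \bar R :=
  (`|noise (y z.1) z.2| `^ 1)%:E.
have mphi : measurable_fun setT phi.
  apply: strongly_measurable_norm_powR; apply: noise_strongly_measurable.
    exact: strongly_measurable_precomp (@measurable_fst _ _ _ _) my.
  exact: measurable_snd.
have phi0 z : (0 <= phi z)%E by rewrite lee_fin powR_ge0.
under eq_integral do rewrite -(powRr1 (normr_ge0 _)).
rewrite [leLHS](fresh_sample_fubini xi_ind mphi phi0).
have mF : measurable_fun setT (fun w : T => \int[P]_w' phi (w, xi0 w'))%E.
  exact: fresh_integral_measurable.
rewrite -[leRHS](integral_cst_probability P).
apply: ge0_le_integral => // [w _|w _]; first exact: integral_ge0.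
have -> : sigma%:E = (sigma `^ 1)%:E by rewrite powRr1// ltW.
have p1 : 0 < 1 :> R /\ 1 <= p by split; last exact: le_trans rp.
exact: (noise_moment (y w) (introT andP p1)).
Qed.

End Oracle.
End NoiseStep.

(** * The momentum iteration *)

Lemma geometric_sum_le (R : realType) (b : R) n : 0 <= b < 1 ->
  \sum_(k < n) b ^+ k <= (1 - b)^-1.
Proof.
move=> /andP[b0 b1]; have d0 : 0 < 1 - b by rewrite subr_gt0.
rewrite -(ler_pM2l d0) mulfV ?gt_eqF//; elim: n => [|n IH].
  by rewrite big_ord0 mulr0.
rewrite big_ord_recl expr0 mulrDr mulr1.
under eq_bigr do rewrite /bump/= exprS.
rewrite -mulr_sumr mulrCA; have := ler_wpM2l b0 IH; lra.
Qed.

(** A geometric recursion without initial error, summed up: the constant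
    $\frac b{1-b}$ is that of the stationary regime. *)
Lemma drift_recursion (R : realType) (b : R) (e h : nat -> R) n :
  e 0 = 0 -> (forall k, e k.+1 <= b * e k + b * h k) ->
  e n + (1 - b) * \sum_(k < n) e k <= b * \sum_(k < n) h k.
Proof.
move=> e0 eS; elim: n => [|n IH]; first by rewrite !big_ord0 e0 !mulr0 addr0.
rewrite !big_ord_recr/= !mulrDr; have := eS n; move: IH; lra.
Qed.

(** The letters stand for sums over the first iterations: $S_G$ of the gradient
    norms, $S_H$ of $L_0+L_1\|\nabla F(x_t)\|$, and $S_E\le S_V+S_e$ of the
    momentum errors, split into noise and drift.  Since $S_H$ contains $S_G$, the
    inequality is solved for $S_G$; the factor $\frac2a-\frac32=2\frac{1-a}a+\frac12$
    adds up drift and curvature. *)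
Lemma absorb_gradient (R : realType)
    (eta a A k rho L0n L1 Delta SG SE SV Se SH : R) :
  0 < eta -> 0 < a -> 0 <= SG -> 0 <= SH ->
  eta * SG <= Delta + 2 * eta * SE + A / 2 * eta ^+ 2 * SH ->
  SE <= SV + Se -> a * Se <= (1 - a) * (A * eta * SH) ->
  SH = L0n + L1 * SG ->
  A * (2 / a - 3 / 2) <= k -> k * (L1 * eta) <= rho -> rho < 1 ->
  SG <= (1 - rho)^-1 * (Delta / eta + k * eta * L0n) + (1 - rho)^-1 * 2 * SV.
Proof.
move=> eta0 a0 SG0 SH0 D hE he HE hk hrho rho1.
have e1 : Se <= (1 - a) / a * (A * eta * SH).
  by rewrite mulrAC ler_pdivlMr// mulrC.
have e2 : eta * SG <= Delta + 2 * eta * SV + k * eta ^+ 2 * SH.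
  apply: le_trans D _.
  have := ler_wpM2r (mulr_ge0 (sqr_ge0 eta) SH0) hk.
  have -> : A * (2 / a - 3 / 2) * (eta ^+ 2 * SH) =
    2 * eta * ((1 - a) / a * (A * eta * SH)) + A / 2 * eta ^+ 2 * SH.
    by field; rewrite gt_eqF.
  have := ler_wpM2l (mulr_ge0 (ler0n R 2) (ltW eta0)) (le_trans hE (lerD (lexx _) e1)).
  lra.
have e3 : SG <= Delta / eta + 2 * SV + k * eta * L0n + rho * SG.
  have h := ler_wpM2r SG0 hrho.
  apply: le_trans (_ : Delta / eta + 2 * SV + k * eta * SH <= _); last first.
    rewrite HE; lra.
  rewrite -(ler_pM2l eta0); apply: le_trans e2 _.
  by rewrite le_eqVlt; apply/orP; left; apply/eqP; field; rewrite gt_eqF.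
rewrite -[_ * 2 * SV]mulrA -mulrDr mulrC ler_pdivlMr ?subr_gt0//; lra.
Qed.

(** One step of the momentum recursion: the old error is contracted, the fresh
    noise cancels, and only the change of the gradient enters. *)
Lemma momentum_identity (R : realType) (B : normedModType R) (b c : R)
    (m s G1 G2 N1 W : dual_space B) :
  b *: m + (1 - b) *: s - G2 - ((b * c) *: N1 + (b *: W + (1 - b) *: (s - G2))) =
  b *: (m - G1 - (c *: N1 + W)) + b *: (G1 - G2).
Proof.
apply: val_inj; apply/funext => u /=.
change (b * m u + (1 - b) * s u - G2 u -
    (b * c * N1 u + (b * W u + (1 - b) * (s u - G2 u))) =
  b * (m u - G1 u - (c * N1 u + W u)) + b * (G1 u - G2 u)).
ring.
Qed.

Section Iterates.

Context (R : realType) (B : normedModType R) (F : B -> R)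
  (L0 L1 Delta1 sigma K p r : R)
  d d' (T : measurableType d) (X : measurableType d') (P : probability T R)
  (xi0 : {RV P >-> X}) (xi : nat -> {RV P >-> X}) (g : B -> X -> dual_space B)
  (x1 : B) (eta beta : R)
  (x : nat -> T -> B) (m : nat -> T -> dual_space B) (dir : nat -> T -> B).
Hypotheses (r1 : 1 <= r) (rp : r <= p) (K1 : 1 <= K) (sigma0 : 0 < sigma).
Hypotheses (L0_ge0 : 0 <= L0) (L1_ge0 : 0 <= L1) (beta01 : 0 <= beta < 1)
  (eta0 : 0 < eta).
Hypothesis F_gap : forall y, F x1 - F y <= Delta1.
Hypothesis F_smooth : L0L1_smooth F L0 L1.
Hypothesis smooth : forall f g : dual_space B,
  `|f + g| `^ r + `|f - g| `^ r <= 2 * (`|f| `^ r + (K * `|g|) `^ r).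
Hypothesis g_meas : oracle_measurable g.
Hypothesis g_mean :
  forall y, has_bochner_mean P (fun w => g y (xi0 w)) (grad F y).
Hypothesis g_moment : forall y,
  ('E_P[(fun w => `|g y (xi0 w) - grad F y| `^ p)%R] <= (sigma `^ p)%:E)%E.
Hypothesis xi_ind : independent_copies xi0 xi.
Hypothesis run : NSSDM xi g x1 (fun=> eta) (fun=> beta) x m dir.

Let alpha : R := 1 - beta.
Let beta0 : 0 <= beta. Proof. by case/andP: beta01. Qed.
Let alpha0 : 0 < alpha. Proof. by rewrite subr_gt0; case/andP: beta01. Qed.
Let alpha1 : alpha <= 1. Proof. by rewrite gerBl. Qed.

Let N (t : nat) (w : T) : dual_space B := noise F g (x t w) (xi t w).

(** The noise in the momentum $m_{k+1}$ is $\beta^kN_1$, from the initialisation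
    with the first sample, plus a tail in which the samples $2,\dots,k+1$ have
    weight at most $\alpha$.  The two parts are kept apart since the first one
    does not shrink with $\alpha$. *)
Fixpoint noise_tail (k : nat) (w : T) : dual_space B :=
  if k is k'.+1 then beta *: noise_tail k' w + alpha *: N k.+1 w else 0.

Definition noise_part (k : nat) (w : T) : dual_space B :=
  beta ^+ k *: N 1 w + noise_tail k w.

Let G k w := `|grad F (x k.+1 w)|.

(** The step to $x_{k+1}$ uses the direction $d_k$, hence only the first $k$
    samples. *)
Lemma iterate_measurable k :
  strongly_measurable measurable (x k.+1 : history_space xi k -> B).
Proof.
elim: k => [|k IH].
  rewrite (_ : x 1 = fun=> x1); first exact: strongly_measurable_cst.
  by apply/funext => w; rewrite (nssdm_point1 run).
rewrite (_ : x k.+2 = fun w => x k.+1 w + eta *: dir k.+1 w); last first.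
  by apply/funext => w; rewrite (nssdm_step run).
apply: strongly_measurableD; last first.
  by apply: strongly_measurableZ; exact: (nssdm_adapted run).
exact: (strongly_measurable_precomp (@history_space_mono _ _ _ _ _ _ xi _ _ (leqnSn k)) IH).
Qed.

Let noise_measurable k :
  strongly_measurable measurable (N k.+1 : history_space xi k.+1 -> dual_space B).
Proof.
apply: noise_strongly_measurable => //.
- exact: L0L1_smooth_continuous F_smooth.
- exact: (strongly_measurable_precomp (@history_space_mono _ _ _ _ _ _ xi _ _ (leqnSn k))
    (iterate_measurable k)).
- by apply: sample_measurable; rewrite leqnn.
Qed.

Lemma noise_tail_measurable k :
  strongly_measurable measurable
    (noise_tail k : history_space xi k.+1 -> dual_space B).
Proof.
elim: k => [|k IH]; first exact: strongly_measurable_cst.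
apply: strongly_measurableD; last first.
  by apply: strongly_measurableZ; exact: noise_measurable.
apply: strongly_measurableZ.
exact: (strongly_measurable_precomp (@history_space_mono _ _ _ _ _ _ xi _ _ (leqnSn k.+1)) IH).
Qed.

Let N_norm_measurable k : measurable_fun setT (fun w : T => `|N k.+1 w|).
Proof.
apply: strongly_measurable_norm.
exact: strongly_measurable_history (noise_measurable k).
Qed.

Let tail_norm_measurable k : measurable_fun setT (fun w : T => `|noise_tail k w|).
Proof.
apply: strongly_measurable_norm.
exact: strongly_measurable_history (noise_tail_measurable k).
Qed.

Lemma noise_part_measurable k :
  measurable_fun setT (fun w : T => `|noise_part k w|).
Proof.
apply: strongly_measurable_norm; apply: strongly_measurableD.
  apply: strongly_measurableZ.
  exact: strongly_measurable_history (noise_measurable 0).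
exact: strongly_measurable_history (noise_tail_measurable k).
Qed.

Lemma grad_norm_measurable k :
  measurable_fun setT (fun w : T => `|grad F (x k.+1 w)|).
Proof.
apply: strongly_measurable_norm.
apply: (strongly_measurable_comp (h := grad F)).
  exact: L0L1_smooth_continuous F_smooth.
exact: strongly_measurable_history (iterate_measurable k).
Qed.

Let N_moment k : (\int[P]_w (`|N k.+1 w|)%:E <= sigma%:E)%E.
Proof.
apply: (@fresh_noise_moment _ _ F _ _ _ _ P xi0 xi g p r) => //.
- exact: L0L1_smooth_continuous F_smooth.
- exact: iterate_measurable.
Qed.

(** The increments of the tail are centred given the past, so their $r$-th
    moments add up; the bound is stable under the recursion because
    $\beta^r\le\beta=1-\alpha$. *)
Lemma noise_tail_moment_r k :
  (\int[P]_w (`|noise_tail k w| `^ r)%:E <=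
    (2 * (K * sigma) `^ r * alpha `^ (r - 1))%:E)%E.
Proof.
have r0 : 0 < r := lt_le_trans ltr01 r1.
have K0 : 0 <= K := le_trans ler01 K1.
pose M := 2 * (K * sigma) `^ r * alpha `^ (r - 1).
have M0 : 0 <= M by rewrite !mulr_ge0 ?powR_ge0.
elim: k => [|k IH].
  under eq_integral do rewrite /= normr0 powR0 ?gt_eqF//.
  by rewrite integral0 lee_fin.
have mIH := @iterate_measurable k.+1.
apply: le_trans (@fresh_noise_step _ _ F _ _ _ _ P xi0 xi g p r K sigma r1 rp K0
  sigma0 smooth (L0L1_smooth_continuous L0_ge0 L1_ge0 F_smooth) g_meas g_mean
  g_moment xi_ind k.+1 (fun w => beta *: noise_tail k w) (x k.+2) alpha
  (ltW alpha0) _ mIH) _.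
  apply: strongly_measurableZ; exact: noise_tail_measurable.
have -> : (\int[P]_w (`|beta *: noise_tail k w| `^ r)%:E =
    (beta `^ r)%:E * \int[P]_w (`|noise_tail k w| `^ r)%:E)%E.
  rewrite -ge0_integralZl ?lee_fin ?powR_ge0//; last first.
    apply: strongly_measurable_norm_powR.
    exact: strongly_measurable_history (noise_tail_measurable k).
  by apply: eq_integral => w _; rewrite normrZ ger0_norm// powRM.
apply: le_trans (leeD2r _ (lee_wpmul2l _ IH)) _; first by rewrite lee_fin powR_ge0.
rewrite -/M -EFinM -EFinD lee_fin.
have -> : 2 * (K * alpha) `^ r * sigma `^ r = alpha * M.
  rewrite /M !powRM ?(ltW alpha0) ?(ltW sigma0)// -(mulr_powRB1 (ltW alpha0) r0).
  ring.
have br : beta `^ r <= beta.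
  have [->|b0] := eqVneq beta 0; first by rewrite powR0 ?gt_eqF.
  have bp : 0 < beta by rewrite lt_neqAle eq_sym b0.
  rewrite -[leRHS]powRr1// ger_powR// bp /=.
  by case/andP: beta01 => _ /ltW.
have := ler_wpM2r M0 br; rewrite /alpha => bM; rewrite mulrBl mul1r.
by rewrite -lerBrDr opprB addrC subrK.
Qed.

Lemma noise_tail_moment k :
  (\int[P]_w (`|noise_tail k w|)%:E <=
    (2 * (sigma * K) * alpha `^ ((r - 1) / r))%:E)%E.
Proof.
have r0 : 0 < r := lt_le_trans ltr01 r1.
have sK : 0 < sigma * K by rewrite mulr_gt0// (lt_le_trans ltr01).
set c := (X in (_ <= X%:E)%E).
have c0 : 0 < c by rewrite mulr_gt0 ?powR_gt0// mulr_gt0.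
rewrite -[X in (_ <= X%:E)%E](powRr1 (ltW c0)).
under eq_integral do rewrite -(powRr1 (normr_ge0 _)).
apply: (@moment_le _ _ _ P (fun w => `|noise_tail k w|) 1 r) => //.
  by rewrite ltr01.
apply: le_trans (noise_tail_moment_r k) _; rewrite lee_fin /c.
have sK2 : 0 <= 2 * (sigma * K) by rewrite mulr_ge0// ltW.
rewrite (powRM _ sK2 (powR_ge0 _ _)) -powRrM divfK ?gt_eqF//.
apply: ler_wpM2r; first exact: powR_ge0.
rewrite (powRM _ (ler0n _ 2) (ltW sK)) [sigma * K]mulrC; apply: ler_wpM2r.
  exact: powR_ge0.
by rewrite -{1}[2](powRr1) // ler_powR// ler1n.
Qed.

(** By the triangle inequality alone, averaging does not increase the mean
    noise.  This matters when $\alpha=1$, where [noise_tail_moment] loses a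
    factor $2K$. *)
Lemma noise_tail_moment1 k :
  (\int[P]_w (`|noise_tail k w|)%:E <= ((1 - beta ^+ k) * sigma)%:E)%E.
Proof.
elim: k => [|k IH].
  under eq_integral do rewrite /= normr0.
  by rewrite integral0 expr0 subrr mul0r.
have mN := N_norm_measurable k.+1.
have mt := tail_norm_measurable k.
apply: (@le_trans _ _ (\int[P]_w (beta%:E * (`|noise_tail k w|)%:E +
    alpha%:E * (`|N k.+2 w|)%:E))%E).
  apply: ge0_le_integral => //.
  - by apply/measurable_EFinP; exact: (tail_norm_measurable k.+1).
  - by apply: emeasurable_funD; apply: measurable_funeM; exact/measurable_EFinP.
  - move=> w _; rewrite -!EFinM -EFinD lee_fin /=.
    by rewrite (le_trans (ler_normD _ _))// !normrZ !ger0_norm// ltW.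
have eN : measurable_fun setT (fun w => (`|N k.+2 w|)%:E).
  exact/measurable_EFinP.
have et : measurable_fun setT (fun w => (`|noise_tail k w|)%:E).
  exact/measurable_EFinP.
have bN w : setT w -> (0 <= beta%:E * (`|noise_tail k w|)%:E)%E.
  by move=> _; rewrite mule_ge0// lee_fin.
have aN w : setT w -> (0 <= alpha%:E * (`|N k.+2 w|)%:E)%E.
  by move=> _; rewrite mule_ge0// lee_fin ltW.
rewrite (ge0_integralD P measurableT bN (measurable_funeM _ et) aN
  (measurable_funeM _ eN)).
rewrite (ge0_integralZl P measurableT et) ?lee_fin//.
rewrite (ge0_integralZl P measurableT eN) ?lee_fin ?(ltW alpha0)//.
apply: le_trans (leeD (lee_wpmul2l _ IH) (lee_wpmul2l _ (N_moment k.+1))) _.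
- by rewrite lee_fin.
- by rewrite lee_fin ltW.
rewrite -!EFinM -EFinD lee_fin exprS /alpha.
rewrite le_eqVlt; apply/orP; left; apply/eqP; ring.
Qed.

Lemma noise_part_moment k (c : R) :
  (\int[P]_w (`|noise_tail k w|)%:E <= c%:E)%E ->
  (\int[P]_w (`|noise_part k w|)%:E <= (beta ^+ k * sigma + c)%:E)%E.
Proof.
move=> hc; have bk : 0 <= beta ^+ k by rewrite exprn_ge0.
have mN := N_norm_measurable 0.
have mt := tail_norm_measurable k.
apply: (@le_trans _ _ (\int[P]_w ((beta ^+ k)%:E * (`|N 1 w|)%:E +
    (`|noise_tail k w|)%:E))%E).
  apply: ge0_le_integral => //.
  - by apply/measurable_EFinP; exact: (noise_part_measurable k).
  - apply: emeasurable_funD; last exact/measurable_EFinP.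
    by apply: measurable_funeM; exact/measurable_EFinP.
  - move=> w _; rewrite -!EFinM -EFinD lee_fin /=.
    by rewrite (le_trans (ler_normD _ _))// normrZ ger0_norm.
have eN : measurable_fun setT (fun w => (`|N 1 w|)%:E).
  exact/measurable_EFinP.
have et : measurable_fun setT (fun w => (`|noise_tail k w|)%:E).
  exact/measurable_EFinP.
have bN w : setT w -> (0 <= (beta ^+ k)%:E * (`|N 1 w|)%:E)%E.
  by move=> _; rewrite mule_ge0// lee_fin.
have tN w : setT w -> (0 <= (`|noise_tail k w|)%:E)%E.
  by move=> _; rewrite lee_fin.
rewrite (ge0_integralD P measurableT bN (measurable_funeM _ eN) tN et).
rewrite (ge0_integralZl P measurableT eN) ?lee_fin//.
rewrite EFinD EFinM; apply: leeD => //.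
by apply: lee_wpmul2l; [rewrite lee_fin|exact: N_moment].
Qed.

Section Pathwise.
Context (w : T).
Hypothesis step_small : L1 * eta < 1.

Let A := (1 - L1 * eta)^-1.
Let E k := `|m k.+1 w - grad F (x k.+1 w)|.
Let H k := L0 + L1 * G k w.
Let A0 : 0 < A. Proof. by rewrite invr_gt0 subr_gt0. Qed.

(** Apart from the noise, the momentum error only comes from the drift of the
    gradient between consecutive points. *)
Lemma momentum_drift n :
  `|m n.+1 w - grad F (x n.+1 w) - noise_part n w| +
  alpha * \sum_(k < n) `|m k.+1 w - grad F (x k.+1 w) - noise_part k w| <=
  beta * \sum_(k < n) (H k * A * eta).
Proof.
apply: (@drift_recursion _ beta
  (fun k => `|m k.+1 w - grad F (x k.+1 w) - noise_part k w|)
  (fun k => H k * A * eta)) => [|k].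
  rewrite /noise_part /= addr0 expr0 scale1r.
  rewrite (nssdm_momentum run)// (nssdm_momentum0 run) (nssdm_point1 run).
  rewrite -scalerDl [beta + _]addrC subrK scale1r /N /noise (nssdm_point1 run).
  by rewrite subrr normr0.
have mS := nssdm_momentum run w (ltn0Sn k.+1).
have xS := nssdm_step run w (ltn0Sn k).
have [d1 _] := nssdm_direction run w (ltn0Sn k).
have drift : `|grad F (x k.+1 w) - grad F (x k.+2 w)| <= H k * A * eta.
  rewrite [x k.+2 w]xS.
  exact: L0L1_smooth_step L0_ge0 L1_ge0 (ltW eta0) F_smooth step_small d1.
rewrite [m k.+2 w]mS.
have -> : noise_part k.+1 w = (beta * beta ^+ k) *: N 1 w +
    (beta *: noise_tail k w + (1 - beta) *: N k.+2 w) by rewrite -exprS.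
rewrite [_ - noise_part k w](_ : _ = m k.+1 w - grad F (x k.+1 w) -
    (beta ^+ k *: N 1 w + noise_tail k w))//.
rewrite (momentum_identity _ _ _ _ (grad F (x k.+1 w))).
apply: le_trans (ler_normD _ _) _; rewrite !normrZ !(ger0_norm beta0).
by rewrite lerD2l ler_wpM2l.
Qed.

Lemma descent_sum n :
  eta * \sum_(k < n) G k w <= F x1 - F (x n.+1 w) + 2 * eta * \sum_(k < n) E k +
    A / 2 * eta ^+ 2 * \sum_(k < n) H k.
Proof.
elim: n => [|n IH].
  by rewrite !big_ord0 !mulr0 !addr0 (nssdm_point1 run) subrr.
rewrite !big_ord_recr/=.
have : eta * G n w <= F (x n.+1 w) - F (x n.+2 w) + 2 * eta * E n +
    H n * A / 2 * eta ^+ 2.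
  rewrite (nssdm_step run w (ltn0Sn n)).
  exact: normalised_step_descent L0_ge0 L1_ge0 (ltW eta0) F_smooth step_small
    (nssdm_direction run w (ltn0Sn n)).
move: IH; lra.
Qed.

(** Everything except the noise is estimated for each outcome separately, so
    that expectations are only taken of the noise. *)
Lemma pathwise_bound n (kappa rho : R) :
  A * (2 / alpha - 3 / 2) <= kappa -> kappa * (L1 * eta) <= rho -> rho < 1 ->
  \sum_(k < n) G k w <= (1 - rho)^-1 *
    (Delta1 / eta + kappa * eta * L0 * n%:R) +
    (1 - rho)^-1 * 2 * \sum_(k < n) `|noise_part k w|.
Proof.
move=> hkappa hrho rho1.
have G0 : 0 <= \sum_(k < n) G k w by apply: sumr_ge0 => k _; exact: normr_ge0.
have HE : \sum_(k < n) H k = L0 * n%:R + L1 * \sum_(k < n) G k w.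
  by rewrite big_split/= sumr_const card_ord -mulr_sumr mulr_natr.
have H0 : 0 <= \sum_(k < n) H k by rewrite HE addr_ge0// mulr_ge0.
have D : eta * \sum_(k < n) G k w <= Delta1 + 2 * eta * \sum_(k < n) E k +
    A / 2 * eta ^+ 2 * \sum_(k < n) H k.
  by apply: le_trans (descent_sum n) _; rewrite !lerD2r.
pose Se := \sum_(k < n) `|m k.+1 w - grad F (x k.+1 w) - noise_part k w|.
have EE : \sum_(k < n) E k <= \sum_(k < n) `|noise_part k w| + Se.
  rewrite -big_split/=; apply: ler_sum => k _; rewrite /E addrC.
  by rewrite -{1}[m k.+1 w - _](subrK (noise_part k w)) ler_normD.
have dr : alpha * Se <= (1 - alpha) * (A * eta * \sum_(k < n) H k).
  have -> : A * eta * \sum_(k < n) H k = \sum_(k < n) (H k * A * eta).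
    by rewrite mulrC mulr_suml; apply: eq_bigr => k _; rewrite mulrA.
  rewrite subKr.
  by apply: le_trans (momentum_drift n); rewrite lerDr.
have := absorb_gradient eta0 alpha0 G0 H0 D EE dr HE hkappa hrho rho1.
by rewrite -[kappa * eta * L0 * _]mulrA.
Qed.

End Pathwise.

Lemma expected_gradient_bound n (kappa rho : R) (nu : nat -> R) :
  L1 * eta < 1 ->
  (1 - L1 * eta)^-1 * (2 / alpha - 3 / 2) <= kappa ->
  0 <= kappa -> kappa * (L1 * eta) <= rho -> rho < 1 ->
  (forall k, (\int[P]_w (`|noise_part k w|)%:E <= (nu k)%:E)%E) ->
  (\sum_(1 <= t < n.+1) 'E_P[(fun w => `|grad F (x t w)|)%R] <=
    ((1 - rho)^-1 * (Delta1 / eta + kappa * eta * L0 * n%:R) +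
     (1 - rho)^-1 * 2 * \sum_(k < n) nu k)%:E)%E.
Proof.
move=> small hk k0 hrho rho1 hnu.
set a := (1 - rho)^-1 * (_ + _); set b := (1 - rho)^-1 * 2.
have Delta0 : 0 <= Delta1 by have := F_gap x1; rewrite subrr.
have rho0 : 0 < (1 - rho)^-1 by rewrite invr_gt0 subr_gt0.
have a0 : 0 <= a.
  rewrite /a mulr_ge0 ?(ltW rho0)// addr_ge0 ?divr_ge0 ?(ltW eta0)//.
  by rewrite !mulr_ge0// ltW.
have b0 : 0 <= b by rewrite mulr_ge0// ltW.
rewrite big_add1/= big_mkord.
rewrite (eq_bigr (fun k : 'I_n => \int[P]_w (`|grad F (x k.+1 w)|)%:E)%E); last first.
  by move=> k _; exact: expectationE.
have mG k : measurable_fun setT (fun w => (`|grad F (x k.+1 w)|)%:E).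
  by apply/measurable_EFinP; exact: grad_norm_measurable.
have mV k : measurable_fun setT (fun w => (`|noise_part k w|)%:E).
  by apply/measurable_EFinP; exact: noise_part_measurable.
have mS : measurable_fun setT (fun w => \sum_(k < n) `|noise_part k w|).
  by apply: measurable_sum => k; exact: noise_part_measurable.
have G0 (k : 'I_n) w : setT w -> (0 <= (`|grad F (x k.+1 w)|)%:E)%E by rewrite lee_fin.
have V0 (k : 'I_n) w : setT w -> (0 <= (`|noise_part k w|)%:E)%E by rewrite lee_fin.
have S0 w : 0 <= \sum_(k < n) `|noise_part k w| by apply: sumr_ge0.
rewrite -(ge0_integral_sum P measurableT (fun k : 'I_n => mG k) G0).
apply: (@le_trans _ _ (\int[P]_w (b * (\sum_(k < n) `|noise_part k w|) + a)%:E)%E).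
  apply: ge0_le_integral => //.
  - by move=> w _; apply: sume_ge0 => k _; rewrite lee_fin.
  - exact: emeasurable_sum.
  - apply/measurable_EFinP; apply: measurable_funD => //.
    exact: measurable_funM.
  - move=> w _; rewrite sumEFin lee_fin addrC.
    exact: pathwise_bound.
rewrite ge0_integral_affine// addrC EFinD.
apply: leeD => //; rewrite (EFinM b); apply: lee_wpmul2l; first by rewrite lee_fin.
under eq_integral do rewrite -sumEFin.
rewrite (ge0_integral_sum P measurableT (fun k : 'I_n => mV k) V0) -sumEFin.
by apply: lee_sum => k _.
Qed.

(** The drift of the gradient and the curvature cost at most $2/\alpha$ times
    the stepsize; as $\eta L_1\le\alpha/5$, at most two fifths of the gradient
    norms are absorbed on the left, whence the factor $\frac53$. *)
Lemma average_gradient_interior n : (1 <= n)%N -> 5 * (L1 * eta) <= alpha ->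
  ((n%:R^-1)%:E * \sum_(1 <= t < n.+1) 'E_P[(fun w => `|grad F (x t w)|)%R] <=
    (5 / 3 * (Delta1 / eta / n%:R + 2 * (L0 * eta / alpha) +
      2 * (sigma / (n%:R * alpha) + 2 * (sigma * K) * alpha `^ ((r - 1) / r))))%:E)%E.
Proof.
move=> n1 small; have n0 : 0 < n%:R :> R by rewrite ltr0n.
have e0 : 0 <= L1 * eta by rewrite mulr_ge0// ltW.
pose c := 2 * (sigma * K) * alpha `^ ((r - 1) / r).
have lt1 : L1 * eta < 1 by move: small alpha1; lra.
have kE : 2 / alpha * (L1 * eta) <= 2 / 5.
  by rewrite mulrAC ler_pdivrMr//; move: small; lra.
have hk : (1 - L1 * eta)^-1 * (2 / alpha - 3 / 2) <= 2 / alpha.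
  by rewrite mulrC ler_pdivrMr ?subr_gt0//; move: kE; lra.
have k0 : 0 <= 2 / alpha by rewrite divr_ge0// ltW.
have r25 : 2 / 5 < 1 :> R by lra.
have h := @expected_gradient_bound n (2 / alpha) (2 / 5)
  (fun k => beta ^+ k * sigma + c) lt1 hk k0 kE r25
  (fun k => noise_part_moment (noise_tail_moment k)).
apply: le_trans (lee_wpmul2l _ h) _; first by rewrite lee_fin invr_ge0 ltW.
rewrite -EFinM lee_fin (_ : (1 - 2 / 5)^-1 = 5 / 3); last by field.
rewrite big_split/= sumr_const card_ord -mulr_suml.
have geo : (\sum_(k < n) beta ^+ k) * sigma <= alpha^-1 * sigma.
  by rewrite ler_wpM2r ?(ltW sigma0)// geometric_sum_le.
rewrite mulrC ler_pdivrMr// -/c -[c *+ n]mulr_natr.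
rewrite [leRHS](_ : _ = 5 / 3 * (Delta1 / eta + 2 / alpha * eta * L0 * n%:R) +
  5 / 3 * 2 * (alpha^-1 * sigma + c * n%:R)); last first.
  by field; rewrite !gt_eqF.
by rewrite lerD2l ler_wpM2l// lerD2r.
Qed.

(** The noise at each time is that of a single sample, of mean norm at most
    $\sigma$, and only one eighth of the gradient norms is absorbed, whence the
    factor $\frac87$. *)
Lemma average_gradient_boundary n : (1 <= n)%N -> beta = 0 ->
  5 * (L1 * eta) <= 1 ->
  ((n%:R^-1)%:E * \sum_(1 <= t < n.+1) 'E_P[(fun w => `|grad F (x t w)|)%R] <=
    (8 / 7 * (Delta1 / eta / n%:R + 5 / 8 * (L0 * eta) + 2 * sigma))%:E)%E.
Proof.
move=> n1 b0 small; have n0 : 0 < n%:R :> R by rewrite ltr0n.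
have e0 : 0 <= L1 * eta by rewrite mulr_ge0// ltW.
have lt1 : L1 * eta < 1 by move: small; lra.
have hk : (1 - L1 * eta)^-1 * (2 / alpha - 3 / 2) <= 5 / 8.
  by rewrite /alpha b0 subr0 mulrC ler_pdivrMr ?subr_gt0//; move: small; lra.
have kE : 5 / 8 * (L1 * eta) <= 1 / 8 by move: small; lra.
have k0 : 0 <= 5 / 8 :> R by lra.
have r18 : 1 / 8 < 1 :> R by lra.
have nu k : (\int[P]_w (`|noise_part k w|)%:E <= sigma%:E)%E.
  have := noise_part_moment (noise_tail_moment1 k).
  by rewrite -mulrDl addrC subrK mul1r.
have h := @expected_gradient_bound n (5 / 8) (1 / 8) (fun=> sigma) lt1 hk k0 kE r18 nu.
apply: le_trans (lee_wpmul2l _ h) _; first by rewrite lee_fin invr_ge0 ltW.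
rewrite -EFinM lee_fin (_ : (1 - 1 / 8)^-1 = 8 / 7); last by field.
rewrite sumr_const card_ord -[sigma *+ n]mulr_natr le_eqVlt; apply/orP; left; apply/eqP.
by field; rewrite !gt_eqF.
Qed.

End Iterates.

(** * Tuning of the parameters *)

Section Tuning.
Context (R : realType).
Implicit Types (r X Y s T : R).

Lemma powR_root_le x y k : 0 < k -> 0 <= x -> 0 <= y :> R ->
  x <= y `^ k^-1 -> x `^ k <= y.
Proof.
move=> k0 x0 y0 h; apply: le_trans (_ : (y `^ k^-1) `^ k <= _).
  by rewrite ge0_ler_powR ?nnegrE ?powR_ge0// ltW.
by rewrite -powRrM mulVf ?gt_eqF// powRr1.
Qed.

Lemma two_fifths_powR r : 1 < r <= 2 ->
  (2 / 5) `^ (r / (2 * r - 1)) <= 14 / 25 :> R.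
Proof.
move=> /andP[r1 r2]; have d0 : 0 < 2 * r - 1 by lra.
have h : 2 / 3 <= r / (2 * r - 1) by rewrite ler_pdivlMr//; lra.
apply: le_trans (_ : (2 / 5) `^ (2 / 3) <= _).
  by rewrite ger_powR//; lra.
(* The exponent is at least 2/3, and cubing reduces to 4/25 <= (14/25)^3. *)
rewrite powRrM; apply: powR_root_le; rewrite ?powR_ge0//; try lra.
by rewrite invrK !powR_mulrn; lra.
Qed.

(** Each candidate for $\alpha=1-\beta$ balances the noise $s\alpha^{(r-1)/r}$
    against one decreasing term, here $X/\alpha$ with $X=\Delta_1L_1/T$ and
    $s=\sigma K$. *)
Lemma candidate_L1 r X s : 1 < r -> 0 < X -> 0 < s ->
  let b := (5 * X / (2 * s)) `^ (r / (2 * r - 1)) in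
  let U := X `^ ((r - 1) / (2 * r - 1)) * s `^ (r / (2 * r - 1)) in
  X / b = (2 / 5) `^ (r / (2 * r - 1)) * U /\
  s * b `^ ((r - 1) / r) = 5 / 2 * ((2 / 5) `^ (r / (2 * r - 1)) * U).
Proof.
move=> r1 X0 s0 b U; have d0 : 0 < 2 * r - 1 by lra.
have r0 : 0 < r by lra.
set th := r / (2 * r - 1).
have thE : (r - 1) / (2 * r - 1) = 1 - th by rewrite /th; field; rewrite gt_eqF.
have c0 : 0 < 2 / 5 :> R by lra.
have bE : b = X `^ th * s `^ (- th) * (2 / 5) `^ (- th).
  rewrite /b -/th (_ : 5 * X / (2 * s) = X * s^-1 * (2 / 5)^-1); last first.
    by field; rewrite gt_eqF.
  have i1 : 0 <= s^-1 by rewrite invr_ge0 ltW.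
  have i2 : 0 <= (2 / 5 : R)^-1 by rewrite invr_ge0; lra.
  rewrite (powRM _ (mulr_ge0 (ltW X0) i1) i2) (powRM _ (ltW X0) i1).
  by rewrite -(powR_inv1 (ltW s0)) -(powR_inv1 (ltW c0)) -!powRrM !mulN1r.
have pw (z u v : R) : 0 < z -> z `^ (u + v) = z `^ u * z `^ v.
  by move=> z0; rewrite powRD// (gt_eqF z0) implybT.
split.
  rewrite bE /U -/th thE pw// !powRN powRr1 ?(ltW X0)//.
  by field; rewrite !gt_eqF// powR_gt0.
have e (z : R) : 0 < z -> (z `^ th) `^ ((r - 1) / r) = z `^ (1 - th).
  move=> z0; rewrite -powRrM -thE /th; congr powR; field; rewrite !gt_eqF//.
have e' (z : R) : 0 < z -> (z `^ (- th)) `^ ((r - 1) / r) = z `^ (th - 1).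
  move=> z0; rewrite -powRrM -[th - 1]opprB -thE /th; congr powR; field; rewrite !gt_eqF//.
rewrite bE !powRM ?mulr_ge0 ?powR_ge0// e// !e'// /U -/th thE !pw// !powRN.
rewrite !powRr1 ?(ltW X0) ?(ltW s0) ?(ltW c0)//.
by field; rewrite !gt_eqF ?powR_gt0.
Qed.

(** The candidate that balances the noise against $\sqrt{Y/\alpha}$ with
    $Y=\Delta_1L_0/T$. *)
Lemma candidate_L0 r Y s : 1 < r -> 0 < Y -> 0 < s ->
  let a := (Y / s ^+ 2) `^ (r / (3 * r - 2)) in
  let W := Y `^ ((r - 1) / (3 * r - 2)) * s `^ (r / (3 * r - 2)) in
  Num.sqrt (Y / a) = W /\ s * a `^ ((r - 1) / r) = W.
Proof.
move=> r1 Y0 s0 a W; have d0 : 0 < 3 * r - 2 by lra.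
have r0 : 0 < r by lra.
set ph := (r - 1) / (3 * r - 2).
have phE : r / (3 * r - 2) = 1 - ph *+ 2.
  by rewrite /ph; field; rewrite gt_eqF.
have pw (z u v : R) : 0 < z -> z `^ (u + v) = z `^ u * z `^ v.
  by move=> z0; rewrite powRD// (gt_eqF z0) implybT.
have aE : a = Y `^ (1 - ph *+ 2) * (s ^+ 2) `^ (- (1 - ph *+ 2)).
  rewrite /a phE powRM ?invr_ge0 ?exprn_ge0 ?(ltW Y0) ?(ltW s0)//.
  by rewrite -[_^-1]powR_inv1 ?exprn_ge0 ?(ltW s0)// -powRrM mulN1r.
have s2 : (s ^+ 2) `^ (1 - ph *+ 2) = (s `^ (1 - ph *+ 2)) ^+ 2.
  by rewrite !expr2 powRM ?(ltW s0).
have Y2 : Y `^ (ph *+ 2) = (Y `^ ph) ^+ 2 by rewrite mulr2n pw.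
have Wge : 0 <= W by rewrite mulr_ge0// powR_ge0.
have W2 : Y / a = W ^+ 2.
  rewrite aE /W -/ph phE powRN s2 exprMn -Y2 pw// powRr1 ?(ltW Y0)// powRN.
  by field; rewrite !gt_eqF ?exprn_gt0 ?powR_gt0.
split; first by rewrite W2 sqrtr_sqr ger0_norm.
rewrite aE powRM ?powR_ge0// -!powRrM.
have -> : (1 - ph *+ 2) * ((r - 1) / r) = ph.
  by rewrite -phE /ph; field; rewrite !gt_eqF.
rewrite mulNr.
have -> : (1 - ph *+ 2) * ((r - 1) / r) = ph.
  by rewrite -phE /ph; field; rewrite !gt_eqF.
rewrite expr2 powRM ?(ltW s0)// /W -/ph phE mulr2n opprD !addrA !pw//.
by rewrite powRr1 ?(ltW s0)//; ring.
Qed.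

(** The candidate that balances the noise against the initialisation error. *)
Lemma candidate_T r T s : 1 < r -> 1 <= T -> 0 < s ->
  let c := T `^ (- (r / (2 * r - 1))) in
  let Z := s / T `^ ((r - 1) / (2 * r - 1)) in
  s / (T * c) = Z /\ s * c `^ ((r - 1) / r) = Z.
Proof.
move=> r1 T1 s0 c Z; have d0 : 0 < 2 * r - 1 by lra.
have r0 : 0 < r by lra.
have T0 : 0 < T by lra.
have pw (z u v : R) : 0 < z -> z `^ (u + v) = z `^ u * z `^ v.
  by move=> z0; rewrite powRD// (gt_eqF z0) implybT.
split.
  rewrite /Z /c -{1}[T]powRr1 ?(ltW T0)// -pw//; congr (_ / _ `^ _).
  by field; rewrite gt_eqF.
rewrite /c -powRrM /Z -powRN; congr (_ * _ `^ _).
by field; rewrite !gt_eqF.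
Qed.

(** The value of $1-\beta$ before it is truncated at $1$. *)
Definition momentum_gap r X Y s T : R :=
  Num.max (Num.max ((Y / s ^+ 2) `^ (r / (3 * r - 2)))
    ((5 * X / (2 * s)) `^ (r / (2 * r - 1)))) (T `^ (- (r / (2 * r - 1)))).

Lemma momentum_gap_gt0 r X Y s T : 1 <= T -> 0 < momentum_gap r X Y s T.
Proof.
move=> T1; rewrite /momentum_gap lt_max [X in _ || X]powR_gt0 ?orbT//.
exact: lt_le_trans ltr01 T1.
Qed.

(** Small momentum gap: the constants $14$ and $10$ come from
    $\frac53(5+10)(\frac25)^{2/3}\le14$, $\frac53(3+4)\le14$ and
    $\frac53(2+4)=10$. *)
Lemma tuned_bound_interior r X Y s T (al : R) : 1 < r <= 2 -> 0 <= X -> 0 <= Y ->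
  0 < s -> 1 <= T -> al = momentum_gap r X Y s T ->
  5 / 3 * (5 * (X / al) + 3 * Num.sqrt (Y / al) + 2 * (s / (T * al)) +
    4 * (s * al `^ ((r - 1) / r))) <=
  14 * (X `^ ((r - 1) / (2 * r - 1)) * s `^ (r / (2 * r - 1))) +
  14 * (Y `^ ((r - 1) / (3 * r - 2)) * s `^ (r / (3 * r - 2))) +
  10 * (s / T `^ ((r - 1) / (2 * r - 1))).
Proof.
move=> r12 X0 Y0 s0 T1 alE; have /andP[r1 r2] := r12.
have th := two_fifths_powR r12.
have al0 : 0 < al by rewrite alE momentum_gap_gt0.
set U := X `^ _ * _; set W := Y `^ _ * _; set Z := s / (T `^ _).
have U0 : 0 <= U by rewrite mulr_ge0// powR_ge0.
have W0 : 0 <= W by rewrite mulr_ge0// powR_ge0.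
have T0 : 0 < T by rewrite (lt_le_trans ltr01).
have Z0 : 0 < Z by apply: divr_gt0 => //; exact: powR_gt0.
pose V := (2 / 5) `^ (r / (2 * r - 1)) * U.
have VU : V <= 14 / 25 * U by rewrite ler_wpM2r.
pose a := (Y / s ^+ 2) `^ (r / (3 * r - 2)).
pose b := (5 * X / (2 * s)) `^ (r / (2 * r - 1)).
pose c := T `^ (- (r / (2 * r - 1))).
have c0 : 0 < c by rewrite powR_gt0.
have [aal bal cal] : [/\ a <= al, b <= al & c <= al].
  by rewrite alE /momentum_gap; split; rewrite !le_max lexx ?orbT.
have psi0 : 0 < (r - 1) / r by rewrite divr_gt0; lra.
have hX : X / al <= V /\ s * b `^ ((r - 1) / r) <= 5 / 2 * V.
  have [X00|Xn0] := eqVneq X 0.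
    rewrite /b X00 mulr0 !mul0r powR0; last by rewrite gt_eqF// divr_gt0; lra.
    rewrite powR0 ?gt_eqF// mulr0; split; rewrite ?mulr_ge0// ?powR_ge0//; lra.
  have Xp : 0 < X by rewrite lt_neqAle eq_sym Xn0.
  have [e1 e2] := candidate_L1 r1 Xp s0; split; last by rewrite e2.
  rewrite -/V in e1; rewrite -[V]e1 ler_wpM2l// lef_pV2// posrE//.
  by rewrite powR_gt0// divr_gt0 ?mulr_gt0.
have hY : Num.sqrt (Y / al) <= W /\ s * a `^ ((r - 1) / r) <= W.
  have [Y00|Yn0] := eqVneq Y 0.
    rewrite /a Y00 !mul0r sqrtr0 powR0; last by rewrite gt_eqF// divr_gt0; lra.
    by rewrite powR0 ?gt_eqF// mulr0.
  have Yp : 0 < Y by rewrite lt_neqAle eq_sym Yn0.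
  have [e1 e2] := candidate_L0 r1 Yp s0; split; last by rewrite e2.
  rewrite -[W]e1 ler_sqrt ?divr_ge0 ?powR_ge0//.
  rewrite ler_wpM2l// lef_pV2// posrE//.
  by rewrite powR_gt0// divr_gt0 ?exprn_gt0.
have [hT1 hT2] := candidate_T r1 T1 s0; rewrite -/c -/Z in hT1 hT2.
have hT : s / (T * al) <= Z.
  rewrite -[Z]hT1 ler_wpM2l ?(ltW s0)// lef_pV2 ?posrE ?mulr_gt0//.
  by rewrite ler_wpM2l// ltW.
case: hX => hX1 hX2; case: hY => hY1 hY2.
have albc : [\/ al = a, al = b | al = c].
  rewrite alE /momentum_gap -/a -/b -/c.
  have [h|h] := leP (Num.max a b) c; first by constructor 3.
  by have [h'|h'] := leP a b; [constructor 2|constructor 1].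
have hal : [\/ s * al `^ ((r - 1) / r) <= W, s * al `^ ((r - 1) / r) <= 5 / 2 * V |
    s * al `^ ((r - 1) / r) <= Z].
  move: albc; case=> ->; [by constructor 1|by constructor 2|constructor 3].
  by rewrite hT2.
have V0 : 0 <= V by rewrite mulr_ge0// powR_ge0.
move: (X / al) (Num.sqrt (Y / al)) (s / (T * al)) (s * al `^ _) hX1 hY1 hT hal.
by move=> q1 q2 q3 q4 h1 h2 h3 [] h4; clear - VU V0 U0 W0 Z0 h1 h2 h3 h4; lra.
Qed.

(** A momentum gap of $1$ means that the noise level is dominated by one of
    the other terms. *)
Lemma tuned_bound_boundary r X Y s sg T : 1 < r -> 0 <= X -> 0 <= Y ->
  0 < s -> sg <= s -> 1 <= T -> 1 <= momentum_gap r X Y s T ->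
  8 / 7 * (5 * X + 13 / 8 * Num.sqrt Y + 2 * sg) <=
  12 * X + 9 * Num.sqrt Y + 10 * (s / T `^ ((r - 1) / (2 * r - 1))).
Proof.
move=> r1 X0 Y0 s0 sgs T1; have T0 : 0 < T := lt_le_trans ltr01 T1.
have d2 : 0 < 2 * r - 1 by lra.
have d3 : 0 < 3 * r - 2 by lra.
have sq0 := sqrtr_ge0 Y.
have Z0 : 0 < s / T `^ ((r - 1) / (2 * r - 1)) by rewrite divr_gt0// powR_gt0.
have p1 (e : R) : 1 `^ e = 1 by rewrite powR1.
have base (z e : R) : 0 <= z -> 0 < e -> 1 <= z `^ e -> 1 <= z.
  move=> z0 e0 h; rewrite leNgt; apply/negP => z1; move: h; rewrite leNgt.
  by rewrite -[X in _ < X](p1 e) gt0_ltr_powR ?nnegrE ?ler01.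
rewrite /momentum_gap !le_max => /orP[/orP[h|h]|h].
- have : 1 <= Y / s ^+ 2.
    by apply: base h; [rewrite divr_ge0// exprn_ge0// ltW|rewrite divr_gt0//; lra].
  rewrite ler_pdivlMr ?exprn_gt0// mul1r => h1.
  have h2 : s <= Num.sqrt Y by rewrite -[s]ger0_norm ?(ltW s0)// -sqrtr_sqr ler_sqrt.
  by move: Z0; lra.
- have : 1 <= 5 * X / (2 * s).
    apply: base h; last by rewrite divr_gt0//; lra.
    by rewrite divr_ge0 ?mulr_ge0// ltW.
  rewrite ler_pdivlMr ?mulr_gt0// mul1r => h1.
  by move: Z0; lra.
- have T1' : T = 1.
    apply/eqP; rewrite eq_le T1 andbT leNgt; apply/negP => Tgt.
    move: h; rewrite leNgt => /negP; apply.
    rewrite powRN invf_lt1 ?powR_gt0// -[X in X < _](p1 (r / (2 * r - 1))).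
    by rewrite gt0_ltr_powR ?nnegrE ?ler01 ?(ltW T0)// divr_gt0//; lra.
  by rewrite T1' p1 divr1; lra.
Qed.

(** Here $70=5\cdot14$, and the exponent is the largest one that occurs when the
    five terms of the bound are solved for $T$. *)
Definition complexity_constant r : R := 70 `^ ((3 * r - 2) / (r - 1)).

(** Each of the five terms is at most $\varepsilon/5$: solve for $T$. *)
Lemma complexity_bound r (A0 A1 s T eps : R) : 1 < r -> 0 <= A0 -> 0 <= A1 ->
  0 < s -> 0 < T -> 0 < eps ->
  complexity_constant r * (A1 / eps + A0 / eps ^+ 2 +
    A1 / eps * (s / eps) `^ (r / (r - 1)) +
    A0 / eps ^+ 2 * (s / eps) `^ (r / (r - 1)) +
    (s / eps) `^ ((2 * r - 1) / (r - 1))) <= T ->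
  12 * (A1 / T) + 9 * Num.sqrt (A0 / T) +
  14 * (A1 * s `^ (r / (r - 1)) / T) `^ ((r - 1) / (2 * r - 1)) +
  14 * (A0 * s `^ (r / (r - 1)) / T) `^ ((r - 1) / (3 * r - 2)) +
  10 * s / T `^ ((r - 1) / (2 * r - 1)) <= eps.
Proof.
move=> r1 A00 A10 s0 T0 e0; have rm : 0 < r - 1 by lra.
set om := r / (r - 1); set C := complexity_constant r.
have om1 : 1 < om by rewrite /om ltr_pdivlMr//; lra.
have E1 : (2 * r - 1) / (r - 1) = 1 + om by rewrite /om; field; rewrite gt_eqF.
have E2 : (3 * r - 2) / (r - 1) = 2 + om by rewrite /om; field; rewrite gt_eqF.
have I1 : (r - 1) / (2 * r - 1) = (1 + om)^-1 by rewrite -E1 invf_div.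
have I2 : (r - 1) / (3 * r - 2) = (2 + om)^-1 by rewrite -E2 invf_div.
have CE : C = 70 `^ (2 + om) by rewrite /C /complexity_constant E2.
have pw (z u v : R) : 0 < z -> z `^ (u + v) = z `^ u * z `^ v.
  by move=> z0; rewrite powRD// (gt_eqF z0) implybT.
have p2 (z : R) : 0 <= z -> z `^ 2 = z ^+ 2 by move=> z0; rewrite powR_mulrn.
have C0 : 0 < C by rewrite CE powR_gt0.
have C1 : 70 `^ (1 + om) <= C by rewrite CE ler_powR; lra.
have C3 : 2025 <= C.
  apply: le_trans (_ : 70 `^ 2 <= _); first by rewrite p2; lra.
  by rewrite CE ler_powR; lra.
rewrite E1 I1 I2.
have so0 : 0 < s `^ om by rewrite powR_gt0.
have eo0 : 0 < eps `^ om by rewrite powR_gt0.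
have -> : (s / eps) `^ om = s `^ om / eps `^ om.
  rewrite powRM ?invr_ge0 ?(ltW s0) ?(ltW e0)//.
  by rewrite -(powR_inv1 (ltW e0)) -powRrM mulN1r powRN.
set q1 := A1 / eps; set q2 := A0 / eps ^+ 2; set q3 := q1 * _; set q4 := q2 * _.
set q5 := (s / eps) `^ (1 + om) => hT.
have q10 : 0 <= q1 by rewrite divr_ge0// ltW.
have q20 : 0 <= q2 by rewrite divr_ge0// exprn_ge0// ltW.
have q30 : 0 <= q3 by rewrite mulr_ge0// divr_ge0// ltW.
have q40 : 0 <= q4 by rewrite mulr_ge0// divr_ge0// ltW.
have q50 : 0 <= q5 by exact: powR_ge0.
have sub (q : R) : q <= q1 + q2 + q3 + q4 + q5 -> C * q <= T.
  by move=> h; apply: le_trans hT; rewrite ler_wpM2l// ltW.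
have T1 : C * q1 <= T by apply: sub; clear - q10 q20 q30 q40 q50; lra.
have T2 : C * q2 <= T by apply: sub; clear - q10 q20 q30 q40 q50; lra.
have T3 : C * q3 <= T by apply: sub; clear - q10 q20 q30 q40 q50; lra.
have T4 : C * q4 <= T by apply: sub; clear - q10 q20 q30 q40 q50; lra.
have T5 : C * q5 <= T by apply: sub; clear - q10 q20 q30 q40 q50; lra.
have e70 : 0 < eps / 70 by rewrite divr_gt0.
have split70 (k : R) : (eps / 70) `^ k = eps `^ k / 70 `^ k.
  rewrite powRM ?(ltW e0) ?invr_ge0//.
  by rewrite -[_^-1]powR_inv1// -powRrM mulN1r powRN.
have h1 : 12 * (A1 / T) <= eps / 5.
  rewrite mulrA ler_pdivrMr//.
  have : 2025 * q1 <= T by apply: le_trans T1; rewrite ler_wpM2r.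
  move=> h; have := ler_wpM2l (ltW e0) h.
  have -> : A1 = q1 * eps by rewrite /q1 divfK ?gt_eqF.
  by have := mulr_ge0 q10 (ltW e0); lra.
have h2 : 9 * Num.sqrt (A0 / T) <= eps / 5.
  have -> : eps / 5 = 9 * (eps / 45) by field.
  rewrite ler_wpM2l// -[leRHS]ger0_norm ?divr_ge0 ?(ltW e0)//.
  rewrite -sqrtr_sqr ler_sqrt ?sqr_ge0// ler_pdivrMr//.
  have : 2025 * q2 <= T by apply: le_trans T2; rewrite ler_wpM2r.
  move=> h; have := ler_wpM2l (exprn_ge0 2 (ltW e0)) h.
  have -> : A0 = q2 * eps ^+ 2 by rewrite /q2 divfK ?gt_eqF ?exprn_gt0.
  lra.
have h3 : 14 * (A1 * s `^ om / T) `^ (1 + om)^-1 <= eps / 5.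
  have -> : eps / 5 = 14 * (eps / 70) by field.
  rewrite ler_wpM2l//; apply: powR_root_le.
  - by rewrite invr_gt0; clear - om1; lra.
  - by apply: divr_ge0; [apply: mulr_ge0 => //; exact: ltW|exact: ltW].
  - exact: ltW.
  rewrite invrK split70 ler_pdivrMr// pw// powRr1 ?(ltW e0)//.
  rewrite mulrAC ler_pdivlMr ?powR_gt0//.
  have -> : A1 * s `^ om = q3 * (eps * eps `^ om).
    by rewrite /q3 /q1; field; rewrite !gt_eqF.
  have le : 70 `^ (1 + om) * q3 <= T by apply: le_trans T3; rewrite ler_wpM2r.
  have := ler_wpM2l (mulr_ge0 (ltW e0) (ltW eo0)) le; lra.
have h4 : 14 * (A0 * s `^ om / T) `^ (2 + om)^-1 <= eps / 5.
  have -> : eps / 5 = 14 * (eps / 70) by field.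
  rewrite ler_wpM2l//; apply: powR_root_le.
  - by rewrite invr_gt0; clear - om1; lra.
  - by apply: divr_ge0; [apply: mulr_ge0 => //; exact: ltW|exact: ltW].
  - exact: ltW.
  rewrite invrK split70 -CE ler_pdivrMr// pw// p2 ?(ltW e0)//.
  rewrite mulrAC ler_pdivlMr//.
  have -> : A0 * s `^ om = q4 * (eps ^+ 2 * eps `^ om).
    by rewrite /q4 /q2; field; rewrite !gt_eqF.
  have := ler_wpM2l (mulr_ge0 (exprn_ge0 2 (ltW e0)) (ltW eo0)) T4; lra.
have h5 : 10 * s / T `^ (1 + om)^-1 <= eps / 5.
  have P0 : 0 < T `^ (1 + om)^-1 by rewrite powR_gt0.
  rewrite ler_pdivrMr//.
  have root : 70 * (s / eps) <= T `^ (1 + om)^-1.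
    have -> : 70 * (s / eps) = ((70 * (s / eps)) `^ (1 + om)) `^ (1 + om)^-1.
      rewrite -powRrM mulfV ?powRr1 ?gt_eqF ?ltr_wpDl//; last lra.
      by rewrite mulr_ge0// divr_ge0 ?(ltW s0) ?(ltW e0).
    rewrite ge0_ler_powR ?nnegrE ?powR_ge0 ?invr_ge0 ?(ltW T0)//; first lra.
    rewrite powRM ?divr_ge0 ?(ltW s0) ?(ltW e0)// -/q5.
    by apply: le_trans T5; rewrite ler_wpM2r.
  have := ler_wpM2l (ltW e0) root.
  rewrite (_ : eps * (70 * (s / eps)) = 70 * s); last by field; rewrite gt_eqF.
  by have := mulr_ge0 (ltW e0) (ltW P0); lra.
lra.
Qed.

(** The two caps on the stepsize: the first keeps the drift below the gap, and
    either of them is inverted when the stepsize equals it. *)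
Lemma nssdm_eta_spec (D L0 L1 beta : R) (n : nat) :
  0 <= D -> 0 <= L0 -> 0 <= L1 -> 0 < L0 + L1 -> (1 <= n)%N -> beta < 1 ->
  let eta := nssdm_eta D L0 L1 n beta in
  [/\ 0 <= eta, 5 * (L1 * eta) <= 1 - beta,
      L0 * eta <= Num.sqrt (D * L0 / n%:R * (1 - beta)),
      eta = 0 -> D = 0 &
      0 < eta -> D / eta / n%:R <=
        5 * (D * L1 / n%:R / (1 - beta)) + Num.sqrt (D * L0 / n%:R / (1 - beta))].
Proof.
move=> D0 L00 L10 L01 n1 b1 eta.
set a := 1 - beta; have a0 : 0 < a by rewrite subr_gt0.
have n0 : 0 < n%:R :> R by rewrite ltr0n.
set N : R := n%:R in n0 *.
pose u := a / (5 * L1); pose v := Num.sqrt (D * a / (L0 * N)).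
have v0 : 0 <= v by exact: sqrtr_ge0.
have cap1 : 0 < L1 -> 0 < u /\ 5 * (L1 * u) = a.
  move=> L1p; rewrite /u divr_gt0 ?mulr_gt0//; split=> //.
  by field; rewrite gt_eqF.
have cap0 : 0 < L0 -> L0 * v = Num.sqrt (D * L0 / N * a) /\
    (0 < v -> D / v / N = Num.sqrt (D * L0 / N / a)).
  move=> L0p; split.
    rewrite -{1}[L0]ger0_norm// -sqrtr_sqr -sqrtrM ?sqr_ge0//; congr Num.sqrt.
    by field; rewrite !gt_eqF.
  move=> vp; have v2 : v ^+ 2 = D * a / (L0 * N).
    by rewrite sqr_sqrtr// divr_ge0 ?mulr_ge0// ltW.
  have Dp : 0 < D.
    rewrite lt_neqAle D0 andbT eq_sym; apply/eqP => D00.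
    by move: vp; rewrite /v D00 !mul0r sqrtr0 ltxx.
  have -> : D / v / N = Num.sqrt ((D / v / N) ^+ 2).
    by rewrite sqrtr_sqr ger0_norm// !divr_ge0// ltW.
  congr Num.sqrt; rewrite !exprMn !exprVn v2.
  by field; rewrite !gt_eqF.
have inv1 : 0 < L1 -> D / u / N = 5 * (D * L1 / N / a).
  by move=> L1p; rewrite /u; field; rewrite !gt_eqF.
have r1 : 0 <= 5 * (D * L1 / N / a) by rewrite !mulr_ge0// invr_ge0 ltW.
have r2 := sqrtr_ge0 (D * L0 / N / a).
have u_le e : 0 < L1 -> e <= u -> 5 * (L1 * e) <= a.
  by move=> L1p eu; have [_ <-] := cap1 L1p; rewrite !ler_wpM2l// ltW.
have v_le e : 0 < L0 -> e <= v -> L0 * e <= Num.sqrt (D * L0 / N * a).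
  by move=> L0p ev; have [<- _] := cap0 L0p; rewrite ler_wpM2l// ltW.
have etav : eta = v -> 0 < L0 -> [/\ eta = 0 -> D = 0 & 0 < eta ->
    D / eta / N <= 5 * (D * L1 / N / a) + Num.sqrt (D * L0 / N / a)].
  move=> -> L0p; split; last by have [_ h] := cap0 L0p; move=> /h->; rewrite lerDr.
  move=> /eqP; rewrite sqrtr_eq0 => h; apply/eqP; rewrite eq_le D0 andbT.
  move: h; rewrite pmulr_lle0 ?invr_gt0 ?mulr_gt0//.
  by rewrite pmulr_lle0.
have etau : eta = u -> 0 < L1 -> [/\ eta = 0 -> D = 0 & 0 < eta ->
    D / eta / N <= 5 * (D * L1 / N / a) + Num.sqrt (D * L0 / N / a)].
  move=> -> L1p; have [up _] := cap1 L1p; split; last by rewrite inv1// lerDl.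
  by move=> u0; rewrite u0 ltxx in up.
have [L1z|L1z] := eqVneq L1 0.
  have L0p : 0 < L0 by rewrite L1z addr0 in L01.
  have etaE : eta = v.
    by rewrite /eta /nssdm_eta L1z mulr0 eqxx mulf_eq0 !gt_eqF//= minye.
  have [h1 h2] := etav etaE L0p; split=> //; rewrite ?etaE//.
    by rewrite L1z mul0r mulr0 ltW.
  exact: v_le.
have L1p : 0 < L1 by rewrite lt_neqAle eq_sym L1z.
have L15 : (5 * L1 == 0) = false by rewrite gt_eqF// mulr_gt0.
have [up _] := cap1 L1p.
have [L0z|L0z] := eqVneq L0 0.
  have etaE : eta = u.
    by rewrite /eta /nssdm_eta L15 L0z mul0r eqxx miney.
  have [h1 h2] := etau etaE L1p; split=> //; rewrite ?etaE ?(ltW up)//.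
    exact: u_le.
  by rewrite L0z mul0r sqrtr_ge0.
have L0p : 0 < L0 by rewrite lt_neqAle eq_sym L0z.
have etaE : eta = Num.min u v.
  rewrite /eta /nssdm_eta L15 gt_eqF ?mulr_gt0//.
  by rewrite -EFin_min.
have eu : eta <= u by rewrite etaE ge_min lexx.
have ev : eta <= v by rewrite etaE ge_min lexx orbT.
have [h1 h2] : [/\ eta = 0 -> D = 0 & 0 < eta ->
    D / eta / N <= 5 * (D * L1 / N / a) + Num.sqrt (D * L0 / N / a)].
  by have [/min_idPl h|/ltW/min_idPr h] := leP u v;
    [apply: etau|apply: etav] => //; rewrite etaE.
split=> //; [|exact: u_le|exact: v_le].
by rewrite etaE le_min v0 ltW.
Qed.

End Tuning.

(** * The convergence rate *)

(** Otherwise a short step against an almost norming vector would decrease $F$. *)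
Lemma smooth_minimum_grad (R : realType) (B : normedModType R) (F : B -> R) (L0 L1 : R) x :
  0 <= L0 -> 0 <= L1 -> L0L1_smooth F L0 L1 -> (forall y, F x <= F y) ->
  `|grad F x| = 0.
Proof.
move=> L00 L10 sF Fmin; apply/eqP; rewrite eq_le normr_ge0 andbT leNgt.
apply/negP => G0; set G := `|grad F x| in G0.
have [u u1 hu] := dual_almost_norming (grad F x) (divr_gt0 G0 (ltr0n R 2)).
rewrite -/G in hu; have {}hu : G / 2 < grad F x u by lra.
pose H := L0 + L1 * G; have H0 : 0 <= H by rewrite addr_ge0// mulr_ge0// ltW.
have [t [t0 t1 t2]] : exists t, [/\ 0 < t, L1 * t <= 1 / 2 & H * t < G / 2].
  have l1 : 0 < 2 * L1 + 1 by lra.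
  have h1 : 0 < 2 * H + 1 by lra.
  exists (Num.min (2 * L1 + 1)^-1 (G / (2 * H + 1))); split.
  - by rewrite lt_min invr_gt0 l1 divr_gt0.
  - apply: le_trans (_ : L1 * (2 * L1 + 1)^-1 <= _).
      by rewrite ler_wpM2l// ge_min lexx.
    by rewrite ler_pdivrMr//; lra.
  - apply: le_lt_trans (_ : H * (G / (2 * H + 1)) < _).
      by rewrite ler_wpM2l// ge_min lexx orbT.
    by rewrite mulrA ltr_pdivrMr//; lra.
have th : `|- t *: u| <= t by rewrite normrZ normrN gtr0_norm// ler_piMr// ltW.
have Lh : L1 * `|- t *: u| <= 1 / 2 by apply: le_trans t1; rewrite ler_wpM2l.
have small : L1 * `|- t *: u| < 1 by lra.
have := smooth_descent x L00 L10 sF small.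
rewrite dualZ -/G -/H; have := Fmin (x + - t *: u).
have A2 : (1 - L1 * `|- t *: u|)^-1 <= 2.
  by rewrite -[leRHS]invrK lef_pV2 ?posrE//; lra.
have A0 : 0 <= (1 - L1 * `|- t *: u|)^-1 by rewrite invr_ge0; lra.
have hh : `|- t *: u| ^+ 2 <= t ^+ 2 by rewrite lerXn2r// nnegrE// ltW.
have : H * (1 - L1 * `|- t *: u|)^-1 / 2 * `|- t *: u| ^+ 2 <= H * 2 / 2 * t ^+ 2.
  apply: ler_pM => //; first by rewrite !mulr_ge0.
  by rewrite ler_wpM2r// ler_wpM2l.
have h1 : t * (G / 2) < t * grad F x u by rewrite ltr_pM2l.
have h2 : t * (H * t) < t * (G / 2) by rewrite ltr_pM2l.
move: h1 h2; lra.
Qed.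

Theorem mainTheorem6 (R : realType) :
  exists C : R -> R,
  forall (p q p' : R) (B : completeNormedModType R) (K : R)
    (F : B -> R) (x1 : B) (Delta1 L0 L1 sigma : R)
    (d d' : measure_display) (Omega : measurableType d)
    (Xi : measurableType d') (P : probability Omega R)
    (xi0 : {RV P >-> Xi}) (xi : nat -> {RV P >-> Xi})
    (g : B -> Xi -> dual_space B) (T : nat)
    (x : nat -> Omega -> B) (m : nat -> Omega -> dual_space B)
    (dir : nat -> Omega -> B),
  1 < p <= 2 -> 2 <= q -> q^-1 + p'^-1 = 1 ->
  let r := Num.min p p' in
  q_uniformly_convex B q -> (q_convexity_constant B q <= K%:E)%E ->
  0 <= L0 -> 0 <= L1 -> 0 < L0 + L1 -> 0 < sigma ->
  ((F x1)%:E - ereal_inf [set (F y)%:E | y in [set: B]] <= Delta1%:E)%E ->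
  L0L1_smooth F L0 L1 ->
  oracle_measurable g ->
  (forall y, has_bochner_mean P (fun w => g y (xi0 w)) (grad F y)) ->
  (forall y, ('E_P[(fun w => `|g y (xi0 w) - grad F y| `^ p)%R]
                <= (sigma `^ p)%:E)%E) ->
  independent_copies xi0 xi ->
  (1 <= T)%N ->
  let beta := nssdm_beta r K Delta1 L0 L1 sigma T in
  let eta := nssdm_eta Delta1 L0 L1 T beta in
  NSSDM xi g x1 (fun=> eta) (fun=> beta) x m dir ->
  let lhs :=
    ((T%:R^-1)%:E *
      \sum_(1 <= t < T.+1) 'E_P[(fun w => `|grad F (x t w)|)%R])%E in
  (lhs <= (12 * (Delta1 * L1 / T%:R)
           + 9 * Num.sqrt (Delta1 * L0 / T%:R)
           + 14 * (Delta1 * L1 * (sigma * K) `^ (r / (r - 1)) / T%:R)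
                    `^ ((r - 1) / (2 * r - 1))
           + 14 * (Delta1 * L0 * (sigma * K) `^ (r / (r - 1)) / T%:R)
                    `^ ((r - 1) / (3 * r - 2))
           + 10 * (sigma * K) / T%:R `^ ((r - 1) / (2 * r - 1)))%:E)%E /\
  (forall eps : R, 0 < eps ->
     C r * (Delta1 * L1 / eps
            + Delta1 * L0 / eps ^+ 2
            + Delta1 * L1 / eps * (sigma * K / eps) `^ (r / (r - 1))
            + Delta1 * L0 / eps ^+ 2 * (sigma * K / eps) `^ (r / (r - 1))
            + (sigma * K / eps) `^ ((2 * r - 1) / (r - 1))) <= T%:R ->
     (lhs <= eps%:E)%E).
Proof.
exists (@complexity_constant R).
move=> p q p' B K F x1 Delta1 L0 L1 sigma d d' Omega Xi P xi0 xi g T x m dir.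
move=> p12 q2 qp r _ hK L00 L10 L01 sigma0 hgap sF g_meas g_mean g_mom ind T1.
move=> beta eta run lhs.
have /andP[p1 p2] := p12.
have q0 : 0 < q by lra.
have q1 : 1 < q by lra.
have iq : q^-1 <= 2^-1 by rewrite lef_pV2 ?posrE.
have ip0 : 0 < p'^-1 by move: qp iq; lra.
have p'0 : 0 < p' by rewrite -invr_gt0.
have p'1 : 1 < p'.
  have iq0 : 0 < q^-1 by rewrite invr_gt0.
  by rewrite -invf_lt1//; move: qp; lra.
have r1 : 1 < r by rewrite lt_min p1.
have r2 : r <= 2 by rewrite /r ge_min p2.
have rp : r <= p by rewrite /r ge_min lexx.
have rp' : r <= p' by rewrite /r ge_min lexx orbT.
have r12 : 1 < r <= 2 by rewrite r1.
have r1w : 1 <= r by exact: ltW.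
have [K1 _] := q_convexity_constant_le q0 hK.
have K0 : 0 < K by exact: lt_le_trans K1.
have smooth : forall f g : dual_space B,
    `|f + g| `^ r + `|f - g| `^ r <= 2 * (`|f| `^ r + (K * `|g|) `^ r).
  by apply: (dual_smooth q1 p'1 qp _ hK); rewrite rp' andbT (lt_trans ltr01).
have gap y : F x1 - F y <= Delta1.
  rewrite -lee_fin EFinB; apply: le_trans hgap; rewrite leeB//.
  by apply: ereal_inf_lbound; exists y.
have Delta0 : 0 <= Delta1 by have := gap x1; rewrite subrr.
have N0 : 0 < T%:R :> R by rewrite ltr0n.
have N1 : 1 <= T%:R :> R by rewrite ler1n.
(* In this notation the bound is a function of $r,X,Y,s$ and $T$ alone. *)
pose X := Delta1 * L1 / T%:R; pose Y := Delta1 * L0 / T%:R; pose s := sigma * K.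
have X0 : 0 <= X by rewrite !mulr_ge0// invr_ge0 ltW.
have Y0 : 0 <= Y by rewrite !mulr_ge0// invr_ge0 ltW.
have s0 : 0 < s by rewrite mulr_gt0.
have sgs : sigma <= s by rewrite /s ler_pMr.
have betaE : beta = 1 - Num.min 1 (momentum_gap r X Y s T%:R).
  have e0 : Delta1 * L0 / (sigma ^+ 2 * K ^+ 2 * T%:R) = Y / s ^+ 2.
    by rewrite /Y /s; field; rewrite !gt_eqF.
  have e1 : 5 * L1 * Delta1 / (2 * sigma * K * T%:R) = 5 * X / (2 * s).
    by rewrite /X /s; field; rewrite !gt_eqF.
  by rewrite /beta /nssdm_beta e0 e1.
have M0 : 0 < momentum_gap r X Y s T%:R by exact: momentum_gap_gt0.
pose alpha := Num.min 1 (momentum_gap r X Y s T%:R).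
have alE : 1 - beta = alpha by rewrite betaE subKr.
have al0 : 0 < alpha by rewrite lt_min ltr01.
have al1 : alpha <= 1 by rewrite ge_min lexx.
have beta01 : 0 <= beta < 1.
  by rewrite betaE subr_ge0 ge_min lexx/= ltrBlDr ltrDl.
have beta1 : beta < 1 by case/andP: beta01.
have [eta_ge0 etaL1 etaL0 eta_eq0 etaD] :=
  nssdm_eta_spec Delta0 L00 L10 L01 T1 beta1.
rewrite -/eta alE in eta_ge0 etaL1 etaL0 eta_eq0 etaD.
pose om := r / (r - 1).
pose rhs := 12 * X + 9 * Num.sqrt Y +
  14 * (Delta1 * L1 * s `^ om / T%:R) `^ ((r - 1) / (2 * r - 1)) +
  14 * (Delta1 * L0 * s `^ om / T%:R) `^ ((r - 1) / (3 * r - 2)) +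
  10 * s / T%:R `^ ((r - 1) / (2 * r - 1)).
suff main : (lhs <= rhs%:E)%E.
  split; first exact: main.
  move=> eps eps0 hC; apply: le_trans main _; rewrite lee_fin.
  by apply: complexity_bound; rewrite ?mulr_ge0.
pose U := X `^ ((r - 1) / (2 * r - 1)) * s `^ (r / (2 * r - 1)).
pose W := Y `^ ((r - 1) / (3 * r - 2)) * s `^ (r / (3 * r - 2)).
pose Z := s / T%:R `^ ((r - 1) / (2 * r - 1)).
have rhsE : rhs = 12 * X + 9 * Num.sqrt Y + 14 * U + 14 * W + 10 * Z.
  have d1 : r - 1 != 0 by rewrite subr_eq0 gt_eqF.
  have d2 : 2 * r - 1 != 0 by rewrite gt_eqF//; clear - r1; lra.
  have d3 : 3 * r - 2 != 0 by rewrite gt_eqF//; clear - r1; lra.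
  have exps (A k : R) : 0 <= A -> (A * s `^ om / T%:R) `^ k =
      (A / T%:R) `^ k * s `^ (om * k).
    move=> A0; have AT : 0 <= A / T%:R by rewrite divr_ge0// ltW.
    by rewrite mulrAC (powRM _ AT (powR_ge0 _ _)) -powRrM.
  have e1 : om * ((r - 1) / (2 * r - 1)) = r / (2 * r - 1).
    by rewrite /om; field; rewrite d1 d2.
  have e2 : om * ((r - 1) / (3 * r - 2)) = r / (3 * r - 2).
    by rewrite /om; field; rewrite d1 d3.
  by rewrite /rhs !exps ?mulr_ge0// e1 e2 /U /W /Z -/X -/Y -[10 * s / _]mulrA.
have U0 : 0 <= U by rewrite mulr_ge0// powR_ge0.
have W0 : 0 <= W by rewrite mulr_ge0// powR_ge0.
have Z0 : 0 <= Z by rewrite divr_ge0 ?powR_ge0// ltW.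
have sqY0 : 0 <= Num.sqrt Y by exact: sqrtr_ge0.
have [eta0|etan0] := eqVneq eta 0.
  (* A zero stepsize forces the starting point to be a minimiser. *)
  have D0 := eta_eq0 eta0.
  have G0 : `|grad F x1| = 0.
    apply: (smooth_minimum_grad L00 L10 sF) => y.
    by have := gap y; rewrite D0 subr_le0.
  have xE t w : x t.+1 w = x1.
    elim: t => [|t IH]; first by rewrite (nssdm_point1 run).
    by rewrite (nssdm_step run)// eta0 scale0r addr0.
  rewrite /lhs big_add1 big1 => [|t _]; last first.
    rewrite expectationE; under eq_integral do rewrite xE G0.
    exact: integral0.
  by rewrite mule0 lee_fin rhsE; clear - X0 sqY0 U0 W0 Z0; lra.
have eta0 : 0 < eta by rewrite lt_neqAle eq_sym etan0.
have {}etaD := etaD eta0.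
rewrite -/X -/Y in etaL0 etaD.
have [M1|M1] := leP 1 (momentum_gap r X Y s T%:R).
  have alpha1 : alpha = 1 by apply/min_idPl.
  have b0 : beta = 0 by rewrite betaE -/alpha alpha1 subrr.
  rewrite alpha1 in etaL1 etaL0 etaD.
  have rate := average_gradient_boundary r1w rp sigma0 L00 L10 beta01 eta0
    gap sF g_meas g_mom ind run T1 b0 etaL1.
  apply: le_trans rate _.
  rewrite lee_fin; have := tuned_bound_boundary r1 X0 Y0 s0 sgs N1 M1.
  rewrite -/Z rhsE; move: etaL0 etaD; rewrite mulr1 !divr1; lra.
have alphaM : alpha = momentum_gap r X Y s T%:R by apply/min_idPr/ltW.
have etaL1' : 5 * (L1 * eta) <= 1 - beta by rewrite alE.
have rate := average_gradient_interior r1w rp K1 sigma0 L00 L10 beta01 eta0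
  gap sF smooth g_meas g_mean g_mom ind run T1 etaL1'.
apply: le_trans rate _.
rewrite lee_fin alE.
have := tuned_bound_interior r12 X0 Y0 s0 N1 alphaM; rewrite -/U -/W -/Z => tuned.
have drift : L0 * eta / alpha <= Num.sqrt (Y / alpha).
  rewrite ler_pdivrMr//; apply: le_trans etaL0 _.
  rewrite -[X in _ <= _ * X]ger0_norm ?(ltW al0)// -sqrtr_sqr -sqrtrM; last first.
    by rewrite divr_ge0// ltW.
  rewrite (_ : Y / alpha * alpha ^+ 2 = Y * alpha)//.
  by field; rewrite gt_eqF.
have first : sigma / (T%:R * alpha) <= s / (T%:R * alpha).
  by rewrite ler_wpM2r// invr_ge0 mulr_ge0// ltW.
rewrite rhsE; apply: le_trans (_ : 14 * U + 14 * W + 10 * Z <= _); last by lra.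
apply: le_trans tuned; rewrite ler_pM2l ?divr_gt0//.
by move: etaD drift first; rewrite -/s; lra.
Qed.
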